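(* Assume $x_{max}\ge\max[a_{max},\epsilon]$ and $Q(0)=Z(0)=0$. Suppose the joint pricing and allocation algorithm (defined in the context) is implemented every slot with fixed parameters $\epsilon\ge0$, $V>0$. Then: (a) For all $t$, $Q(t)\le Q_{max}=V\gamma_{max}+a_{max}$, and every request is fulfilled with delay at most $D_{max}=\left\lceil(2V\gamma_{max}+a_{max}+\epsilon)/\epsilon\right\rceil$ slots (for $\epsilon=0$ one reads $D_{max}=\infty$, so that no delay assertion is made). (b) If the vector $(s(t),y(t),\gamma(t))$ is i.i.d. over slots, and if $\epsilon\le\max[a^*,\mathbb{E}\{s(t)\}]$, then $$\frac1t\sum_{\tau=0}^{t-1}\mathbb{E}\{\phi(\tau)\}\ge\phi^*-B/V\qquad\text{for all } t>0,$$ where $$B=\frac{(s_{max}+x_{max})^2+a_{max}^2}{2}+\frac{\max[\epsilon^2,(s_{max}+x_{max})^2]}{2},$$ and $\phi^*$ is the optimal (supremum) time average profit and $a^*$ the associated mean request rate, both defined in the context.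
   Context: Time is slotted, $t\in\{0,1,2,\ldots\}$. The supply $s(t)$ and outside market price $\gamma(t)$ are stochastic processes with $0\le s(t)\le s_{max}$, $0\le\gamma(t)\le\gamma_{max}$ (finite constants); $y(t)$ is a stochastic process called the demand state, known at the beginning of slot $t$. Every slot the controller chooses: $x(t)$ with $0\le x(t)\le x_{max}$ (outside energy, $x_{max}$ finite); $b(t)\in\{0,1\}$ ($b(t)=1$ means new requests are accepted; if $b(t)=0$ no requests are accepted, so $a(t)=0$); and, if $b(t)=1$, a price $p(t)$ with $0\le p(t)\le p_{max}$. The arriving requests $a(t)$ always satisfy $0\le a(t)\le a_{max}$; they are conditionally i.i.d. over all slots with the same $p(t),y(t),\gamma(t)$ (in particular their conditional law given these does not depend on the past history or queue states), with $$\mathbb{E}\{a(t)\mid p(t),y(t),\gamma(t),b(t)=1\}=F(p(t),y(t),\gamma(t)),$$ where the demand function $F(p,y,\gamma)$ is continuous in $p$ for each given $y,\gamma$. Queues: $Q(t+1)=\max[Q(t)-s(t)-x(t),0]+a(t)$ (actual queue of energy requests) and $Z(t+1)=\max[Z(t)-s(t)-x(t)+\epsilon1_{\{Q(t)>0\}},0]$ (virtual queue), where $1_{\{Q(t)>0\}}$ is $1$ if $Q(t)>0$ and $0$ otherwise. Profit on slot $t$: $\phi(t)=b(t)p(t)a(t)-\gamma(t)x(t)$. Delay: service is First-In-First-Out. Requests $a(t)$ are first available for service on slot $t+1$ and are part of $Q(t+1)$. On slot $\tau$ the amount served is $\min[Q(\tau),s(\tau)+x(\tau)]$. The requests $a(t)$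 are fulfilled with delay at most $D$ slots if they are served on or before slot $t+D$, i.e. $\sum_{\tau=t+1}^{t+D}\min[Q(\tau),s(\tau)+x(\tau)]\ge Q(t+1)$. Joint pricing and allocation algorithm: every slot $t$, observe $Q(t),Z(t),s(t),\gamma(t),y(t)$. Choose $p(t)$ as a maximizer of $F(p,y(t),\gamma(t))\,(Vp-Q(t))$ over $0\le p\le p_{max}$; if the maximum value is non-negative choose $b(t)=1$, else choose $b(t)=0$. Choose $x(t)=0$ if $Q(t)+Z(t)\le V\gamma(t)$ and $x(t)=x_{max}$ otherwise. Then update $Q$ and $Z$. Optimality (case $(s(t),y(t),\gamma(t))$ i.i.d. over slots): $\phi^*$ is the supremum of the limiting time average profit $\overline\phi=\lim_{t\to\infty}\frac1t\sum_{\tau=0}^{t-1}\mathbb{E}\{\phi(\tau)\}$ over all algorithms satisfying $\limsup_{t\to\infty}\frac1t\sum_{\tau=0}^{t-1}\mathbb{E}\{Q(\tau)\}<\infty$, $0\le x(t)\le x_{max}$, $b(t)\in\{0,1\}$ and $0\le p(t)\le p_{max}$ for all $t$. An $(s,y,\gamma)$-only policy chooses $x^*(t)\in[0,x_{max}]$, $b^*(t)\in\{0,1\}$, $p^*(t)\in[0,p_{max}]$ by a stationary, possibly randomized, rule depending only on $s(t),y(t),\gamma(t)$; $a^*(t)$ denotes the resulting random requests. It is known (and taken as given) that there exists an $(s,y,\gamma)$-only policy with $$\mathbb{E}\{b^*(t)p^*(t)a^*(t)-\gamma(t)x^*(t)\}=\phi^*,\qquad \mathbb{E}\{a^*(t)-s(t)-x^*(t)\}\le0.$$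 Define $a^*=\mathbb{E}\{a^*(t)\}$ for such a policy; if the policy is not unique, $a^*$ is the maximum value of $\mathbb{E}\{a^*(t)\}$ over $(s,y,\gamma)$-only policies satisfying these two conditions. *)

(* Defs.v *)
(* MathComp-Analysis, over an abstract realType. *)
From mathcomp Require Import all_boot all_order all_algebra.
From mathcomp Require Import all_classical all_reals all_analysis.

Set Implicit Arguments.
Unset Strict Implicit.
Unset Printing Implicit Defensive.
Import Order.TTheory GRing.Theory Num.Theory.
Import numFieldNormedType.Exports.

Local Open Scope classical_set_scope.
Local Open Scope ring_scope.

Section model.
Context (R : realType) (dY : measure_display) (Y : measurableType dY).

(* A system operated by some control algorithm: [supply] is s, [demand_state]
   is y, [market_price] is gamma, [outside] is x, [accept] is b, [price] is p,
   [requests] is a. States (s, y, gamma) live in R * Y * R, decisions (x, b, p)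
   in R * bool * R. *)
Record run (d : measure_display) (T : measurableType d) (P : probability T R) :=
  Run {
    supply : nat -> {RV P >-> R} ;
    demand_state : nat -> {RV P >-> Y} ;
    market_price : nat -> {RV P >-> R} ;
    outside : nat -> {RV P >-> R} ;
    accept : nat -> {RV P >-> bool} ;
    price : nat -> {RV P >-> R} ;
    requests : nat -> {RV P >-> R} }.

Section run_defs.
Context (d : measure_display) (T : measurableType d) (P : probability T R).
Variable r : run P.

Definition state_at (t : nat) (w : T) : R * Y * R :=
  (supply r t w, demand_state r t w, market_price r t w).

Definition decision_at (t : nat) (w : T) : R * bool * R :=
  (outside r t w, accept r t w, price r t w).

Definition before_requests (t : nat) (w : T) : (R * Y * R) * (R * bool * R) :=
  (state_at t w, decision_at t w).

Definition slot (t : nat) (w : T) : (R * Y * R) * (R * bool * R) * R :=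
  (before_requests t w, requests r t w).

Definition history_gen (t : nat) : set_system T :=
  \bigcup_(tau in `I_t) preimage_set_system setT (slot tau) measurable.

(* Events determined by the states, decisions and requests of slots < t. *)
Definition history (t : nat) : set_system T := <<s history_gen t >>.

(* Events known just before the requests of slot t arrive: the history together
   with the state and decision of slot t. *)
Definition decision_history (t : nat) : set_system T :=
  <<s history_gen t `|`
      preimage_set_system setT (before_requests t) measurable >>.

Fixpoint Q (t : nat) (w : T) : R :=
  if t is t'.+1 then
    Num.max (Q t' w - supply r t' w - outside r t' w) 0 + requests r t' w
  else 0.

Fixpoint Z (eps : R) (t : nat) (w : T) : R :=
  if t is t'.+1 then
    Num.max (Z eps t' w - supply r t' w - outside r t' w
             + eps * (0 < Q t' w)%R%:R) 0
  else 0.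

Definition profit (t : nat) (w : T) : R :=
  (accept r t w)%:R * price r t w * requests r t w
  - market_price r t w * outside r t w.

Definition served (t : nat) (w : T) : R :=
  Num.min (Q t w) (supply r t w + outside r t w).

(* Under first-in-first-out service, the requests of slot t have all been
   served by the end of slot t + D. *)
Definition fulfilled_within (D t : nat) (w : T) : Prop :=
  Q t.+1 w <= \sum_(t.+1 <= tau < (t + D).+1) served tau w.

Definition time_average (f : nat -> T -> R) (t : nat) : \bar R :=
  ((t%:R^-1)%:E * \sum_(tau < t) 'E_P[f tau])%E.

End run_defs.

(* [A (p, y, gamma)] is the law of the requests of one slot at price p, demand
   state y and market price gamma, when requests are accepted. *)
Variable A : R.-pker (R * Y * R)%type ~> R.

Definition demand_model (F : R -> Y -> R -> R) (gmax amax pmax : R) : Prop :=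
  (forall (p : R) (y : Y) (g : R), 0 <= p <= pmax -> 0 <= g <= gmax ->
     A (p, y, g) `[0, amax]%classic = 1%E /\
     (\int[A (p, y, g)]_c c%:E = (F p y g)%:E)%E) /\
  (forall (y : Y) (g : R), 0 <= g <= gmax ->
     {within `[0, pmax], continuous (fun p : R => F p y g)}).

(* The last clause is the defining property of a conditional law: given all
   that is known before the arrivals of slot t, on {b(t) = 1} the conditional
   law of a(t) is A (p(t), y(t), gamma(t)). *)
Definition valid_run (d : measure_display) (T : measurableType d)
    (P : probability T R) (smax gmax amax xmax pmax : R) (r : run P) : Prop :=
  [/\ (forall t w, 0 <= supply r t w <= smax) /\
      (forall t w, 0 <= market_price r t w <= gmax),
      (forall t w, 0 <= outside r t w <= xmax) /\
      (forall t w, 0 <= price r t w <= pmax),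
      (forall t w, 0 <= requests r t w <= amax) /\
      (forall t w, accept r t w = false -> requests r t w = 0) &
      forall t (H : set T) (U : set R), decision_history r t H -> measurable U ->
        P (H `&` accept r t @^-1` [set true] `&` requests r t @^-1` U)
        = (\int[P]_(w in H `&` accept r t @^-1` [set true])
             A (price r t w, demand_state r t w, market_price r t w) U)%E].

(* The states are i.i.d. with law mu. Independence is from the whole history,
   so that decisions cannot anticipate future states. *)
Definition iid_states (mu : probability (R * Y * R)%type R)
    (d : measure_display) (T : measurableType d) (P : probability T R)
    (r : run P) : Prop :=
  (forall t (U : set (R * Y * R)), measurable U ->
     P (state_at r t @^-1` U) = mu U) /\
  (forall t (H : set T) (U : set (R * Y * R)), history r t H -> measurable U ->
     P (H `&` state_at r t @^-1` U)
     = (P H * P (state_at r t @^-1` U))%E).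

(* Ties between maximizing prices are broken arbitrarily. *)
Definition joint_pricing_allocation (F : R -> Y -> R -> R) (xmax pmax eps V : R)
    (d : measure_display) (T : measurableType d) (P : probability T R)
    (r : run P) : Prop :=
  forall t w,
    let value (q : R) :=
      F q (demand_state r t w) (market_price r t w) * (V * q - Q r t w) in
    [/\ 0 <= price r t w <= pmax,
        forall q : R, 0 <= q <= pmax -> value q <= value (price r t w),
        accept r t w = (0 <= value (price r t w)) &
        outside r t w =
          if Q r t w + Z r eps t w <= V * market_price r t w then 0 else xmax].

Definition phi_star (mu : probability (R * Y * R)%type R)
    (smax gmax amax xmax pmax : R) : R :=
  sup [set v | exists (d : measure_display) (T : measurableType d)
      (P : probability T R) (r : run P),
    [/\ valid_run smax gmax amax xmax pmax r,
        iid_states mu r,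
        (limn_esup (time_average P (Q r)) < +oo)%E &
        time_average P (profit r) @ \oo --> v%:E]].

(* An (s, y, gamma)-only policy is a kernel giving the law of the decision. *)
Definition feasible_policy (xmax pmax : R)
    (pi : R.-pker (R * Y * R)%type ~> (R * bool * R)%type) : Prop :=
  forall z, pi z [set u | 0 <= u.1.1 <= xmax /\ 0 <= u.2 <= pmax] = 1%E.

(* Expectation of g (s, y, gamma) (x, b, p) a in one slot under pi. *)
Definition policy_expectation (mu : probability (R * Y * R)%type R)
    (pi : R.-pker (R * Y * R)%type ~> (R * bool * R)%type)
    (g : R * Y * R -> R * bool * R -> R -> R) : \bar R :=
  (\int[mu]_z \int[pi z]_u
     (if u.1.2 then \int[A (u.2, z.1.2, z.2)]_c (g z u c)%:E
      else (g z u 0%R)%:E))%E.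

Definition optimal_policy (mu : probability (R * Y * R)%type R)
    (smax gmax amax xmax pmax : R)
    (pi : R.-pker (R * Y * R)%type ~> (R * bool * R)%type) : Prop :=
  [/\ feasible_policy xmax pmax pi,
      policy_expectation mu pi
        (fun z u c => u.1.2%:R * u.2 * c - z.2 * u.1.1)
      = (phi_star mu smax gmax amax xmax pmax)%:E &
      (policy_expectation mu pi (fun z u c => (c - z.1.1 - u.1.1)%R) <= 0)%E].

Definition a_star (mu : probability (R * Y * R)%type R)
    (smax gmax amax xmax pmax : R) : R :=
  sup [set v | exists2 pi, optimal_policy mu smax gmax amax xmax pmax pi &
    policy_expectation mu pi (fun _ _ c => c) = v%:E].

End model.

Definition Qmax (R : realType) (V gmax amax : R) : R := V * gmax + amax.

(* The argument of the ceiling is non-negative in all uses. *)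
Definition Dmax (R : realType) (V gmax amax eps : R) : nat :=
  `|Num.ceil ((2 * V * gmax + amax + eps) / eps)|%N.

Definition Bconst (R : realType) (smax xmax amax eps : R) : R :=
  ((smax + xmax) ^+ 2 + amax ^+ 2) / 2
  + Num.max (eps ^+ 2) ((smax + xmax) ^+ 2) / 2.

(* Main.v *)
Require Import Defs.
From mathcomp Require Import all_boot all_order all_algebra.
From mathcomp Require Import finmap.
From mathcomp Require Import all_classical all_reals all_analysis.
From mathcomp Require Import measurable_realfun.
From mathcomp Require Import lra.
Import Order.TTheory GRing.Theory Num.Theory.
Import numFieldNormedType.Exports.
Local Open Scope classical_set_scope.
Local Open Scope ring_scope.
Set Implicit Arguments.
Unset Strict Implicit.
Unset Printing Implicit Defensive.

(** Part (a) holds on every sample path. Once [Q] or [Z] exceeds the level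
    [V * gmax], the purchase rule buys [xmax], and this covers both the arrivals
    of a slot and the increment [eps] of [Z]; so [Q] stays below
    [V * gmax + amax] ([Q_le]) and [Z] below [V * gmax + eps] ([Z_le]). Requests
    that are late keep the queue nonempty, during which [Z] gains [eps] per slot
    and loses only what is served. Over [Dmax] slots this would push [Z] above
    its bound ([fulfilled_within_Dmax]).

    Part (b) is a Lyapunov drift argument with the function [(Q^2 + Z^2) / 2].
    Squaring the queue updates bounds its increment by a constant plus
    [Q * (a - s - x) + Z * (eps - s - x)] ([lyapunov_drift]). Once [V] times the
    profit is subtracted, the decisions of the algorithm minimize the
    conditional mean of this bound over all admissible decisions, so it may be
    compared with an arbitrary policy that looks at the state only
    ([max_weight]). For an optimal such policy the profit is [phi_star] and the
    mean drift of [Q] is at most [0]. The mean drift of [Z] is at most [0] up to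
    an arbitrarily small [delta], because [eps] is at most the mean supply or at
    most [a_star], and the mean of [s + x] is an upper bound for the mean
    requests ([near_optimal_policy]). Since the state of a slot is independent of
    the queues, expectations factor and the mean increment of the function,
    minus [V] times the mean profit, is at most
    [B - V * phi_star + (V * gmax + eps) * delta] ([mean_drift]). Summing over
    the slots telescopes.

    What remains is measure theory. The conditional law of the requests and the
    independence of the states are given on events; [mean_disintegration] turns
    both into statements on expectations, by the usual passage from indicators
    to simple functions to limits. Policy expectations are computed after
    replacing their integrands by bounded measurable functions that agree with
    them almost surely ([policy_expectationE]). *)

(** * Queue and delay bounds on a sample path *)

Section pathwise.
Context {R : realType} {dY : measure_display} {Y : measurableType dY}.
Context {d : measure_display} {T : measurableType d} {P : probability T R}.
Variable r : run Y P.
Variables (smax gmax amax xmax eps V : R) (w : T).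
Hypothesis supply_bounds : forall t, 0 <= supply r t w <= smax.
Hypothesis outside_bounds : forall t, 0 <= outside r t w <= xmax.
Hypothesis requests_bounds : forall t, 0 <= requests r t w <= amax.
Hypothesis market_bounds : forall t, 0 <= market_price r t w <= gmax.

Lemma Q_ge0 t : 0 <= Q r t w.
Proof.
case: t => [//|t] /=; apply: addr_ge0; first by rewrite le_max lexx orbT.
by have /andP[] := requests_bounds t.
Qed.

Lemma Z_ge0 t : 0 <= Z r eps t w.
Proof. by case: t => [//|t] /=; rewrite le_max lexx orbT. Qed.

Lemma Q_recE t : Q r t.+1 w =
  Num.max (Q r t w - supply r t w - outside r t w) 0 + requests r t w.
Proof. by []. Qed.

Lemma Z_recE t : Z r eps t.+1 w = Num.max
  (Z r eps t w - supply r t w - outside r t w + eps * (0 < Q r t w)%R%:R) 0.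
Proof. by []. Qed.

Lemma Q_stepE t : Q r t.+1 w = Q r t w - served r t w + requests r t w.
Proof.
rewrite Q_recE /served; congr (_ + _).
by rewrite /Num.max /Num.min; case: ltP => ?; case: ltP => ?; lra.
Qed.

(** Arrivals join the end of the line, so one slot of the window that clears the
    whole queue has served every older request. *)
Lemma fulfilled_of_empty t D tau : (t < tau < (t + D).+1)%N ->
  Q r tau w <= supply r tau w + outside r tau w -> fulfilled_within r D t w.
Proof.
move=> /andP[ttau tauD] emptied.
have backlog n : (t < n)%N ->
    Q r t.+1 w <= \sum_(t.+1 <= k < n) served r k w + Q r n w.
  elim: n => // n IH; rewrite ltnS leq_eqVlt => /predU1P[<-|tn].
    by rewrite big_geq// add0r.
  have -> : \sum_(t.+1 <= k < n.+1) served r k w =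
      \sum_(t.+1 <= k < n) served r k w + served r n w by rewrite big_nat_recr.
  apply: (le_trans (IH tn)); rewrite Q_stepE.
  by have := requests_bounds n; lra.
have served_ge0 n : 0 <= served r n w.
  rewrite le_min Q_ge0/=.
  by have /andP[] := supply_bounds n; have /andP[] := outside_bounds n; lra.
rewrite /fulfilled_within (big_cat_nat (n := tau.+1))//=; last exact: leqW.
rewrite big_nat_recr//= -[leLHS]addr0; apply: lerD; last exact: sumr_ge0.
by rewrite {2}/served min_l//; exact: backlog.
Qed.

(** As long as the queue outlasts the service offered, [Z] receives [eps] and
    loses exactly what is served; truncation at zero only raises it. *)
Lemma Z_after_busy m n : (forall tau, (m <= tau < m + n)%N ->
    supply r tau w + outside r tau w < Q r tau w) ->
  n%:R * eps + Z r eps m w <=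
  Z r eps (m + n) w + \sum_(m <= tau < m + n) served r tau w.
Proof.
elim: n => [|n IH] busy; first by rewrite addn0 big_geq// mul0r addr0 add0r.
have /IH {}IH : forall tau, (m <= tau < m + n)%N ->
    supply r tau w + outside r tau w < Q r tau w.
  by move=> tau /andP[mt tn]; apply: busy; rewrite mt addnS ltnS ltnW.
have Qn : supply r (m + n) w + outside r (m + n) w < Q r (m + n) w.
  by apply: busy; rewrite leq_addr addnS /=.
have -> : \sum_(m <= tau < m + n.+1) served r tau w =
    \sum_(m <= tau < m + n) served r tau w +
    (supply r (m + n) w + outside r (m + n) w).
  by rewrite addnS big_nat_recr ?leq_addr//= {2}/served min_r// ltW.
rewrite addnS.
have Qpos : 0 < Q r (m + n) w.
  by have := supply_bounds (m + n); have := outside_bounds (m + n); lra.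
rewrite Z_recE Qpos mulr1 -natr1 mulrDl mul1r.
have : Z r eps (m + n) w - supply r (m + n) w - outside r (m + n) w + eps <=
  Num.max (Z r eps (m + n) w - supply r (m + n) w - outside r (m + n) w + eps) 0.
  by rewrite le_max lexx.
by move: IH; lra.
Qed.

Hypothesis amax_le : amax <= xmax.
Hypothesis eps_le : eps <= xmax.
Hypothesis eps_ge0 : 0 <= eps.
Hypothesis V_gt0 : 0 < V.
Hypothesis outsideE : forall t, outside r t w =
  if Q r t w + Z r eps t w <= V * market_price r t w then 0 else xmax.

Let price_level_le t : 0 <= V * market_price r t w <= V * gmax.
Proof.
have /andP[g0 g1] := market_bounds t.
by rewrite mulr_ge0 ?(ltW V_gt0)//= ler_pM2l.
Qed.

(** Above the level [V * gmax] the rule buys [xmax], which covers whatever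
    arrives; below that level one slot adds at most [amax]. *)
Lemma Q_le t : Q r t w <= Qmax V gmax amax.
Proof.
rewrite /Qmax; elim: t => [|t IH].
  by have := price_level_le 0; have := requests_bounds 0; rewrite /=; lra.
have /andP[s0 _] := supply_bounds t; have /andP[x0 _] := outside_bounds t.
have /andP[a0 a1] := requests_bounds t; have /andP[v0 v1] := price_level_le t.
have z0 := Z_ge0 t.
have [level|x_big] : Q r t w + Z r eps t w <= V * market_price r t w \/
    xmax <= outside r t w by rewrite outsideE; case: leP; [left|right].
  by move: amax_le; rewrite Q_recE /Num.max; case: ltP => ? ?; lra.
by move: amax_le; rewrite Q_recE /Num.max; case: ltP => ? ?; lra.
Qed.

Lemma Z_le t : Z r eps t w <= V * gmax + eps.
Proof.
elim: t => [|t IH]; first by have := price_level_le 0; have := eps_ge0;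
  rewrite /=; lra.
have /andP[s0 _] := supply_bounds t; have /andP[x0 _] := outside_bounds t.
have /andP[v0 v1] := price_level_le t; have q0 := Q_ge0 t.
have inc : 0 <= eps * (0 < Q r t w)%R%:R <= eps.
  by case: (0 < Q r t w)%R; rewrite ?mulr1 ?mulr0 ?lexx ?eps_ge0.
have z0 := Z_ge0 t.
have [level|x_big] : Q r t w + Z r eps t w <= V * market_price r t w \/
    xmax <= outside r t w by rewrite outsideE; case: leP; [left|right].
  by move: eps_le; rewrite Z_recE /Num.max; case: ltP => ? ?; lra.
by move: eps_le; rewrite Z_recE /Num.max; case: ltP => ? ?; lra.
Qed.

(** If some of these requests outlived the window, the backlog would exceed the
    service offered throughout it, so [Z] would gain [eps] per slot and lose
    less than [Qmax] in total, ending above its own bound. *)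
Lemma fulfilled_within_Dmax t : 0 < eps ->
  fulfilled_within r (Dmax V gmax amax eps) t w.
Proof.
move=> eps_gt0; set D := Dmax _ _ _ _.
have [[tau tauD emptied]|never] := pselect (exists2 tau,
    (t < tau < (t + D).+1)%N & Q r tau w <= supply r tau w + outside r tau w).
  exact: fulfilled_of_empty emptied.
have busy tau : (t.+1 <= tau < t.+1 + D)%N ->
    supply r tau w + outside r tau w < Q r tau w.
  move=> tauD; rewrite ltNge; apply/negP => emptied.
  by apply: never; exists tau.
rewrite /fulfilled_within leNgt; apply/negP => late.
have := Z_after_busy busy; rewrite addSn => gain.
have Dlarge : 2 * V * gmax + amax + eps <= D%:R * eps.
  rewrite -ler_pdivrMr//; apply: (le_trans (ceil_ge _)).
  by rewrite /D /Dmax -[leRHS]pmulrn natr_absz intr_norm ler_norm.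
have := Z_le (t + D).+1; have := Q_le t.+1; have := Z_ge0 t.+1.
by move: gain late Dlarge; rewrite /Qmax; lra.
Qed.

End pathwise.

(** * Integrals over sets of full measure *)

Section full_sets.
Context {d : measure_display} {T : measurableType d} {R : realType}.
Variables (m : {measure set T -> \bar R}) (S : set T).
Hypotheses (mS : measurable S) (mSC : m (~` S) = 0%E).
Import HBNNSimple.
Local Open Scope ereal_scope.

(** The integral of a non-negative [f] is a supremum over the simple functions
    below [f], and cutting such a function down to [S] leaves its integral
    unchanged. This covers arbitrary [f] and [g], as is required for the
    integrands of policy expectations, which are uncontrolled off [S]. *)
Lemma ge0_le_integral_full (f g : T -> \bar R) :
  (forall x, 0 <= f x) -> (forall x, 0 <= g x) ->
  (forall x, S x -> f x <= g x) -> \int[m]_x f x <= \int[m]_x g x.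
Proof.
move=> f0 g0 fg; rewrite !ge0_integralTE//; apply: ge_ereal_sup => _ [h hf <-].
have -> : sintegral m h = sintegral m (proj_nnsfun h mS).
  rewrite -!integralT_nnsfun (ge0_negligible_integral (measurableC mS))//;
    [|exact/measurable_EFinP|by move=> x _; rewrite lee_fin].
  rewrite setDE setCK setTI integral_mkcond; apply: eq_integral => x _.
  by rewrite patchE /= /mindic indicE; case: (x \in S); rewrite ?mulr1 ?mulr0.
apply: ereal_sup_ubound; exists (proj_nnsfun h mS) => //= x.
rewrite /mindic indicE; case: (boolP (x \in S)) => [/set_mem Sx|_].
  by rewrite mulr1; exact: le_trans (hf x) (fg x Sx).
by rewrite mulr0.
Qed.

Lemma eq_integral_full (f g : T -> \bar R) :
  (forall x, S x -> f x = g x) -> \int[m]_x f x = \int[m]_x g x.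
Proof.
move=> fg; rewrite [LHS]integralE [RHS]integralE.
have eq_part (p q : T -> \bar R) : (forall x, 0 <= p x) -> (forall x, 0 <= q x) ->
    (forall x, S x -> p x = q x) -> \int[m]_x p x = \int[m]_x q x.
  move=> p0 q0 pq; apply/eqP; rewrite eq_le.
  by apply/andP; split; apply: ge0_le_integral_full => // x Sx; rewrite pq.
by congr (_ - _); apply: eq_part => // x Sx;
  rewrite ?funeposE ?funenegE fg.
Qed.

End full_sets.

(** * Means of bounded measurable functions *)

Section bounded_measurable.
Context {d : measure_display} {T : measurableType d} {R : realType}.
Implicit Types f g : T -> R.

(** The class in which all expectations below are taken: it is stable under the
    arithmetic operations, and its members are integrable for every measure of
    total mass one. *)
Definition bounded_mfun f :=
  measurable_fun setT f /\ exists M, forall x, `|f x| <= M.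

Lemma bounded_mfun_cst c : bounded_mfun (fun=> c).
Proof. by split; [exact: measurable_cst|exists `|c|]. Qed.

Lemma bounded_mfunD f g : bounded_mfun f -> bounded_mfun g ->
  bounded_mfun (fun x => f x + g x).
Proof.
move=> [mf [M fM]] [mg [N gN]]; split; first exact: measurable_funD.
by exists (M + N) => x; rewrite (le_trans (ler_normD _ _))// lerD.
Qed.

Lemma bounded_mfunM f g : bounded_mfun f -> bounded_mfun g ->
  bounded_mfun (fun x => f x * g x).
Proof.
move=> [mf [M fM]] [mg [N gN]]; split; first exact: measurable_funM.
by exists (M * N) => x; rewrite normrM ler_pM.
Qed.

Lemma bounded_mfunN f : bounded_mfun f -> bounded_mfun (fun x => - f x).
Proof.
move=> [mf [M fM]]; split; first exact: measurableT_comp.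
by exists M => x; rewrite normrN.
Qed.

Lemma bounded_mfun_itv f a b : measurable_fun setT f ->
  (forall x, a <= f x <= b) -> bounded_mfun f.
Proof.
move=> mf fab; split => //; exists (Num.max `|a| `|b|) => x.
have /andP[af fb] := fab x; rewrite le_max.
have [f0|f0] := leP 0 (f x); apply/orP; [right|left].
  by rewrite !ger0_norm// (le_trans f0).
by rewrite !ltr0_norm ?lerN2// (le_lt_trans af).
Qed.

End bounded_measurable.

Lemma bounded_mfun_comp {d d'} {T : measurableType d} {T' : measurableType d'}
    {R : realType} (h : T' -> T) (f : T -> R) :
  measurable_fun setT h -> bounded_mfun f -> bounded_mfun (fun x => f (h x)).
Proof.
by move=> mh [mf [M fM]]; split; [exact: measurableT_comp|exists M => x].
Qed.

(** Proves membership in the class by recursion on the syntax of the function;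
    matching on the head keeps unification from unfolding the leaves. *)
Ltac bounded := lazymatch goal with
  | |- bounded_mfun (fun _ => ?c) => exact: bounded_mfun_cst
  | |- bounded_mfun (fun x => @?f x + @?g x) =>
      apply: (@bounded_mfunD _ _ _ f g); bounded
  | |- bounded_mfun (fun x => @?f x * @?g x) =>
      apply: (@bounded_mfunM _ _ _ f g); bounded
  | |- bounded_mfun (fun x => - @?f x) => apply: (@bounded_mfunN _ _ _ f); bounded
  | |- bounded_mfun (fun x => @?f x ^+ 2) =>
      apply: (@bounded_mfunM _ _ _ f f); bounded
  | _ => try done
  end.

Section mean.
Context {d : measure_display} {T : measurableType d} {R : realType}.
Variable m : {measure set T -> \bar R}.
Hypothesis m1 : m setT = 1%E.
Implicit Types f g : T -> R.

Lemma full_setC (S : set T) : measurable S -> m S = 1%E -> m (~` S) = 0%E.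
Proof.
move=> mS S1; by rewrite -setTD measureD//= ?setTI ?m1 ?S1 ?ltry// subee.
Qed.

Lemma integrable_bounded f : bounded_mfun f -> m.-integrable setT (EFin \o f).
Proof.
move=> [mf [M fM]]; apply: measurable_bounded_integrable => //.
  by rewrite m1 ltry.
by exists M; split; [exact: num_real|] => N MN x _; exact: le_trans (fM x) (ltW MN).
Qed.

Lemma meanE f : bounded_mfun f -> (\int[m]_x (f x)%:E)%E = (\int[m]_x f x)%:E.
Proof.
move=> bf; rewrite /Rintegral fineK//.
exact/integrable_fin_num/integrable_bounded.
Qed.

Lemma mean_cst c : \int[m]_x c = c.
Proof. by rewrite Rintegral_cst// m1 mulr1. Qed.

Lemma meanD f g : bounded_mfun f -> bounded_mfun g ->
  \int[m]_x (f x + g x) = \int[m]_x f x + \int[m]_x g x.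
Proof. by move=> bf bg; rewrite RintegralD//; exact: integrable_bounded. Qed.

Lemma meanZ c f : bounded_mfun f -> \int[m]_x (c * f x) = c * \int[m]_x f x.
Proof. by move=> bf; rewrite RintegralZl//; exact: integrable_bounded. Qed.

Lemma meanDZD c f g h : bounded_mfun f -> bounded_mfun g -> bounded_mfun h ->
  \int[m]_x (f x + c * g x + h x) =
  \int[m]_x f x + c * \int[m]_x g x + \int[m]_x h x.
Proof.
move=> bf bg bh; rewrite (meanD (f := fun x => f x + c * g x))//; last by bounded.
by rewrite (meanD (g := fun x => c * g x))// ?meanZ//; bounded.
Qed.

Lemma meanB f g : bounded_mfun f -> bounded_mfun g ->
  \int[m]_x (f x - g x) = \int[m]_x f x - \int[m]_x g x.
Proof. by move=> bf bg; rewrite RintegralB//; exact: integrable_bounded. Qed.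

Lemma le_mean_full (S : set T) f g : measurable S -> m S = 1%E ->
  bounded_mfun f -> bounded_mfun g -> (forall x, S x -> f x <= g x) ->
  \int[m]_x f x <= \int[m]_x g x.
Proof.
move=> mS S1 bf bg fg; pose k x := Num.min (f x) (g x).
have bk : bounded_mfun k.
  split; first exact: measurable_minr (proj1 bf) (proj1 bg).
  have [_ [M fM]] := bf; have [_ [N gN]] := bg; exists (Num.max M N) => x.
  by rewrite /k /Num.min; case: ifP; rewrite le_max ?fM ?gN ?orbT.
have -> : \int[m]_x f x = \int[m]_x k x.
  congr fine; apply: (eq_integral_full mS (full_setC mS S1)) => // x /fg fgx.
  by rewrite /k min_l.
apply: le_Rintegral; [by []|exact: integrable_bounded..|] => x _.
by rewrite /k ge_min lexx orbT.
Qed.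

Lemma le_mean f g : bounded_mfun f -> bounded_mfun g ->
  (forall x, f x <= g x) -> \int[m]_x f x <= \int[m]_x g x.
Proof. by move=> bf bg fg; exact: (le_mean_full measurableT). Qed.

Lemma mean_itv f a b : bounded_mfun f -> (forall x, a <= f x <= b) ->
  a <= \int[m]_x f x <= b.
Proof.
move=> bf fab; apply/andP; split.
  rewrite -[leLHS]mean_cst; apply: le_mean => // [|x].
    exact: bounded_mfun_cst.
  by have /andP[] := fab x.
rewrite -[leRHS]mean_cst; apply: le_mean => // [|x].
  exact: bounded_mfun_cst.
by have /andP[] := fab x.
Qed.

End mean.

(** * Disintegration along a conditional law *)

Section nonneg_induction.
Context {d : measure_display} {T : measurableType d} {R : realType}.
Import HBNNSimple.
Local Open Scope ereal_scope.

(** A property of non-negative measurable functions that holds for indicators and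
    passes to linear combinations and increasing limits of finite functions
    holds for all of them, by approximation with simple functions. *)
Lemma ge0_mfun_ind (C : (T -> \bar R) -> Prop) :
  (forall A, measurable A -> C (fun x => (\1_A x)%:E)) ->
  (forall (k : R) f g, (0 <= k)%R ->
     (forall x, 0 <= f x) -> measurable_fun setT f -> C f ->
     (forall x, 0 <= g x) -> measurable_fun setT g -> C g ->
     C (fun x => k%:E * f x + g x)) ->
  (forall F : nat -> T -> R, (forall n x, (0 <= F n x)%R) ->
     (forall n, measurable_fun setT (F n)) ->
     (forall x, nondecreasing_seq (F ^~ x)) ->
     (forall n, C (fun x => (F n x)%:E)) ->
     C (fun x => limn (fun n => (F n x)%:E))) ->
  forall f, (forall x, 0 <= f x) -> measurable_fun setT f -> C f.
Proof.
move=> C1 CD Clim f f0 mf.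
have Csimple (h : {nnsfun T >-> R}) : C (fun x => (h x)%:E).
  have -> : (fun x => (h x)%:E) = (fun x =>
      \sum_(y <- fset_set (range h)) y%:E * (\1_(h @^-1` [set y]) x)%:E).
    apply/funext => x; rewrite fimfunE fsbig_finite//= -sumEFin.
    by apply: eq_bigr => y _; rewrite EFinM.
  have : {in enum_fset (fset_set (range h)), forall y : R, (0 <= y)%R}.
    move=> y; rewrite -[_ \in _]/(y \in fset_set (range h)) in_fset_set//.
    move=> /set_mem[x _ <-].
    exact: fun_ge0.
  have mh y : measurable (h @^-1` [set y]) by exact: measurable_sfunP.
  elim: (enum_fset _) => [_|y s IH y0].
    rewrite [X in C X](_ : _ = (fun x => (\1_(@set0 T) x)%:E)).
      exact: C1.
    by apply/funext => x; rewrite big_nil indic0.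
  have s0 : {in s, forall z : R, (0 <= z)%R}.
    by move=> z zs; apply: y0; rewrite in_cons zs orbT.
  rewrite [X in C X](_ : _ = (fun x => y%:E * (\1_(h @^-1` [set y]) x)%:E +
      \sum_(y <- s) y%:E * (\1_(h @^-1` [set y]) x)%:E)); last first.
    by apply/funext => x; rewrite big_cons.
  apply: CD.
  - by apply: y0; rewrite in_cons eqxx.
  - by move=> x; rewrite lee_fin.
  - exact/measurable_EFinP/measurable_indic.
  - exact: C1.
  - move=> x; rewrite big_seq; apply: sume_ge0 => z zs.
    by rewrite -EFinM lee_fin mulr_ge0// s0.
  - apply: emeasurable_sum => z; apply: measurable_funeM.
    exact/measurable_EFinP/measurable_indic.
  - exact: IH.
have -> : f = (fun x => limn (fun n => (nnsfun_approx measurableT mf n x)%:E)).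
  by apply/funext => x; apply/esym/cvg_lim => //; exact: cvg_nnsfun_approx.
apply: Clim => //.
by move=> x m n mn; exact/lefP/nd_nnsfun_approx.
Qed.

End nonneg_induction.

Section disintegration.
Context {d : measure_display} {T : measurableType d} {R : realType}.
Context {dE : measure_display} {E : measurableType dE}.
Context {dS : measure_display} {S : measurableType dS}.
Variables (P : probability T R) (G : set_system T) (B : set T).
Variables (a : T -> E) (h : T -> S) (k : R.-pker S ~> E).
Hypotheses (G_measurable : <<s G >> `<=` measurable) (mB : measurable B).
Hypotheses (ma : measurable_fun setT a) (mh : measurable_fun setT h).
Hypothesis law : forall (H : set T) (U : set E), <<s G >> H -> measurable U ->
  P (H `&` B `&` a @^-1` U) = (\int[P]_(w in H `&` B) k (h w) U)%E.

Lemma measurable_fun_sub d' (S' : measurableType d') (X : T -> S') :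
  measurable_fun setT (X : g_sigma_algebraType G -> S') -> measurable_fun setT X.
Proof. by move=> mX _ U mU; apply: G_measurable; exact: (mX measurableT). Qed.

Let measurable_k U : measurable U -> measurable_fun setT (fun w => k (h w) U).
Proof. by move=> mU; exact: measurableT_comp (measurable_kernel k U mU) mh. Qed.

Let measurable_preim U : measurable U -> measurable (a @^-1` U).
Proof. by move=> mU; rewrite -[X in measurable X]setTI; exact: ma. Qed.

Local Open Scope ereal_scope.

(** The hypothesis [law] is the case where [X] is an indicator; it extends to all
    non-negative [X] known from [G], for a fixed event [U] on [a]. *)
Lemma disintegration_indic (U : set E) (X : T -> \bar R) : measurable U ->
  (forall w, 0 <= X w) ->
  measurable_fun setT (X : g_sigma_algebraType G -> \bar R) ->
  \int[P]_(w in B) (X w * (\1_U (a w))%:E) = \int[P]_(w in B) (X w * k (h w) U).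
Proof.
move=> mU; have mUa : measurable_fun setT (fun w => (\1_U (a w))%:E : \bar R).
  by apply/measurable_EFinP; exact: measurableT_comp (measurable_indic _) ma.
have mkU := measurable_k mU.
have sub := measurable_fun_sub.
apply: (@ge0_mfun_ind _ (g_sigma_algebraType G) R (fun X : T -> \bar R =>
  \int[P]_(w in B) (X w * (\1_U (a w))%:E) =
  \int[P]_(w in B) (X w * k (h w) U))) => /=.
- move=> H GH; have mH := G_measurable GH.
  transitivity (P (H `&` B `&` a @^-1` U)).
    rewrite setIAC -integral_indic//; last first.
      by apply: measurableI => //; exact: measurable_preim.
    by apply: eq_integral => w _; rewrite indicI /= EFinM.
  rewrite law// setIC integral_mkcondr; apply: eq_integral => w _.
  by rewrite patchE indicE; case: (w \in H); rewrite ?mul1e ?mul0e.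
- move=> c f g c0 f0 mf IHf g0 mg IHg.
  have split_integral (q : T -> \bar R) : (forall w, 0 <= q w) ->
      measurable_fun setT q -> \int[P]_(w in B) ((c%:E * f w + g w) * q w) =
      c%:E * \int[P]_(w in B) (f w * q w) + \int[P]_(w in B) (g w * q w).
    move=> q0 mq.
    have mfq : measurable_fun B (fun w => f w * q w).
      by apply: measurable_funTS; apply: emeasurable_funM => //; exact: sub.
    have mgq : measurable_fun B (fun w => g w * q w).
      by apply: measurable_funTS; apply: emeasurable_funM => //; exact: sub.
    rewrite -ge0_integralZl// => [|w _]; last exact: mule_ge0.
    rewrite -ge0_integralD// => [|w _||w _]; last exact: mule_ge0.
    + apply: eq_integral => w _.
      by rewrite ge0_muleDl ?mule_ge0// muleA.
    + by rewrite mule_ge0// mule_ge0.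
    + exact: measurable_funeM.
  by rewrite !split_integral ?IHf ?IHg// => w; rewrite lee_fin.
- move=> F F0 mF ndF IH.
  have lim_integral (q : T -> \bar R) : (forall w, 0 <= q w) ->
      (forall w, q w \is a fin_num) ->
      measurable_fun setT q ->
      \int[P]_(w in B) (limn (fun n => (F n w)%:E) * q w) =
      limn (fun n => \int[P]_(w in B) ((F n w)%:E * q w)).
    move=> q0 qfin mq; rewrite -monotone_convergence//; last first.
    + move=> w _ m n mn; apply: lee_wpmul2r => //.
      by rewrite lee_fin; exact: ndF.
    + by move=> n w _; rewrite mule_ge0// lee_fin.
    + move=> n; apply: measurable_funTS; apply: emeasurable_funM => //.
      by apply/measurable_EFinP; exact: sub.
    apply: eq_integral => w _; rewrite limeMr//.
    by apply: ereal_nondecreasing_is_cvgn => m n mn; rewrite lee_fin; exact: ndF.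
  rewrite !lim_integral//.
  + by congr (lim (_ @ \oo)); apply/funext => n; exact: IH.
  + move=> w; rewrite ge0_fin_numE//.
    apply: (@le_lt_trans _ _ (k (h w) setT)).
      by apply: le_measure; rewrite ?inE.
    by rewrite (@prob_kernel _ _ _ _ _ k) ltry.
Qed.

(** Now [X] is fixed and the indicator of [U] is replaced by a general [f]. *)
Lemma ge0_disintegration (X : T -> R) (f : E -> \bar R) :
  (forall w, (0 <= X w)%R) ->
  measurable_fun setT (X : g_sigma_algebraType G -> R) ->
  (forall e, 0 <= f e) -> measurable_fun setT f ->
  \int[P]_(w in B) ((X w)%:E * f (a w)) =
  \int[P]_(w in B) ((X w)%:E * \int[k (h w)]_e f e).
Proof.
move=> X0 mXG.
have mX : measurable_fun setT (fun w => (X w)%:E).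
  by apply/measurable_EFinP; exact: measurable_fun_sub.
have XE0 w : 0 <= (X w)%:E by rewrite lee_fin.
have mint g : (forall e, 0 <= g e) -> measurable_fun setT g ->
    measurable_fun setT (fun w => \int[k (h w)]_e g e).
  move=> g0 mg.
  apply: (measurableT_comp (f := fun s => \int[k s]_e g e)) mh.
  by apply: measurable_fun_integral_kernel => // U mU; exact: measurable_kernel.
have int0 g : (forall e, 0 <= g e) -> forall w, 0 <= \int[k (h w)]_e g e.
  by move=> g0 w; exact: integral_ge0.
apply: (ge0_mfun_ind (C := fun f => \int[P]_(w in B) ((X w)%:E * f (a w)) =
  \int[P]_(w in B) ((X w)%:E * \int[k (h w)]_e f e))).
- move=> U mU; under [RHS]eq_integral do rewrite integral_indic// setIT.
  by apply: disintegration_indic => //; apply/measurable_EFinP.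
- move=> c f1 f2 c0 f10 mf1 IH1 f20 mf2 IH2.
  have split_integral (q1 q2 : T -> \bar R) :
      (forall w, 0 <= q1 w) -> measurable_fun setT q1 ->
      (forall w, 0 <= q2 w) -> measurable_fun setT q2 ->
      \int[P]_(w in B) ((X w)%:E * (c%:E * q1 w + q2 w)) =
      c%:E * \int[P]_(w in B) ((X w)%:E * q1 w) +
      \int[P]_(w in B) ((X w)%:E * q2 w).
    move=> q10 mq1 q20 mq2.
    have m1 : measurable_fun B (fun w => (X w)%:E * q1 w).
      by apply: measurable_funTS; exact: emeasurable_funM.
    have m2 : measurable_fun B (fun w => (X w)%:E * q2 w).
      by apply: measurable_funTS; exact: emeasurable_funM.
    rewrite -ge0_integralZl// => [|w _]; last exact: mule_ge0.
    rewrite -ge0_integralD// => [|w _||w _]; last exact: mule_ge0.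
    + apply: eq_integral => w _.
      by rewrite ge0_muleDr ?mule_ge0// muleCA.
    + by rewrite mule_ge0// mule_ge0.
    + exact: measurable_funeM.
  have ma1 : measurable_fun setT (fun w => f1 (a w)) by exact: measurableT_comp.
  have ma2 : measurable_fun setT (fun w => f2 (a w)) by exact: measurableT_comp.
  rewrite (split_integral (fun w => f1 (a w)) (fun w => f2 (a w)))//.
  rewrite IH1 IH2.
  rewrite -(split_integral _ _ (int0 _ f10) (mint _ f10 mf1)
    (int0 _ f20) (mint _ f20 mf2)).
  apply: eq_integral => w _; congr (_ * _).
  rewrite ge0_integralD// => [|e _|]; last 2 first.
  + by rewrite mule_ge0.
  + exact: measurable_funeM.
  by rewrite ge0_integralZl.
- move=> F F0 mF ndF IH.
  have lim_integral (q : nat -> T -> \bar R) : (forall n w, 0 <= q n w) ->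
      (forall n, measurable_fun setT (q n)) ->
      (forall w, nondecreasing_seq (q ^~ w)) ->
      \int[P]_(w in B) ((X w)%:E * limn (q ^~ w)) =
      limn (fun n => \int[P]_(w in B) ((X w)%:E * q n w)).
    move=> q0 mq ndq; rewrite -monotone_convergence//; last first.
    + by move=> w _ m n mn; apply: lee_wpmul2l => //; exact: ndq.
    + by move=> n w _; rewrite mule_ge0.
    + by move=> n; apply: measurable_funTS; exact: emeasurable_funM.
    apply: eq_integral => w _; rewrite limeMl//.
    exact: ereal_nondecreasing_is_cvgn.
  rewrite (lim_integral (fun n w => (F n (a w))%:E)); last 3 first.
  + by move=> n w; rewrite lee_fin.
  + by move=> n; apply/measurable_EFinP; exact: measurableT_comp.
  + by move=> w m n mn; rewrite lee_fin; exact: ndF.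
  transitivity (limn (fun n => \int[P]_(w in B)
      ((X w)%:E * \int[k (h w)]_e (F n e)%:E))).
    by congr (lim (_ @ \oo)); apply/funext => n; exact: IH.
  rewrite -(lim_integral (fun n w => \int[k (h w)]_e (F n e)%:E)).
  + apply: eq_integral => w _; congr (_ * _).
    rewrite monotone_convergence//.
    * by move=> n; apply/measurable_EFinP.
    * by move=> n e _; rewrite lee_fin.
    * by move=> e _ m n mn; rewrite lee_fin; exact: ndF.
  + by move=> n; apply: int0 => e; rewrite lee_fin.
  + move=> n; apply: mint => [e|]; first by rewrite lee_fin.
    exact/measurable_EFinP.
  + move=> w m n mn; apply: ge0_le_integral => //.
    * by move=> e _; rewrite lee_fin.
    * exact/measurable_EFinP.
    * exact/measurable_EFinP.
    * by move=> e _; rewrite lee_fin; exact: ndF.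
Qed.

End disintegration.

Section kernel_mean.
Context {d : measure_display} {T : measurableType d} {R : realType}.
Context {dE : measure_display} {E : measurableType dE}.
Context {dS : measure_display} {S : measurableType dS}.

Lemma pker_setT (k : R.-pker S ~> E) s : k s setT = 1%E.
Proof. exact: (@prob_kernel _ _ _ _ _ k). Qed.

Lemma bounded_mfun_kernel_mean (k : R.-pker S ~> E) (f : S * E -> R) :
  bounded_mfun f -> bounded_mfun (fun s => \int[k s]_e f (s, e)).
Proof.
move=> [mf [M fM]].
have bf s : bounded_mfun (fun e => f (s, e)).
  by split; [exact: measurable_fun_pair2|exists M].
have fitv x : - M <= f x <= M by rewrite -ler_norml.
split; last first.
  by exists M => s; rewrite ler_norml; exact: (mean_itv (pker_setT k s)).
(* adding the bound reduces to a non-negative integrand *)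
have -> : (fun s => \int[k s]_e f (s, e)) =
    (fun s => fine (\int[k s]_e (f (s, e) + M)%:E)%E - M).
  apply/funext => s; rewrite -[fine _]/(\int[k s]_e (f (s, e) + M)).
  rewrite (meanD (pker_setT k s))//; last exact: bounded_mfun_cst.
  by rewrite (mean_cst (pker_setT k s)) addrK.
apply: measurable_funB => //; apply: measurableT_comp; first exact: fine_measurable.
apply: (measurable_fun_integral_finite_kernel (fun x => (f x + M)%:E) k).
  by move=> x; rewrite lee_fin; have := fitv x; lra.
by apply/measurable_EFinP; exact: measurable_funD.
Qed.

(** Both probabilistic hypotheses of the model are instances of [law]. For the
    requests, [k (h w)] is the demand kernel at the current price, demand state
    and market price, and [B] is the event of acceptance. For the states, [k] is
    constant, [B] is everything, and [law] is independence from the past. *)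
Lemma mean_disintegration (P : probability T R) (G : set_system T) (B : set T)
    (a : T -> E) (h : T -> S) (k : R.-pker S ~> E) (X : T -> R) (f : E -> R) :
  <<s G >> `<=` measurable -> measurable B ->
  measurable_fun setT a -> measurable_fun setT h ->
  (forall (H : set T) (U : set E), <<s G >> H -> measurable U ->
    P (H `&` B `&` a @^-1` U) = (\int[P]_(w in H `&` B) k (h w) U)%E) ->
  (forall w, 0 <= X w) ->
  measurable_fun setT (X : g_sigma_algebraType G -> R) ->
  (forall e, 0 <= f e) -> bounded_mfun f ->
  \int[P]_w (X w * \1_B w * f (a w)) =
  \int[P]_w (X w * \1_B w * \int[k (h w)]_e f e).
Proof.
move=> GT mB ma mh law X0 mX f0 bf.
have restrict (q : T -> R) : (\int[P]_w (X w * \1_B w * q w) =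
    fine (\int[P]_(w in B) ((X w)%:E * (q w)%:E)%E))%R.
  rewrite [in RHS]integral_mkcond; congr fine; apply: eq_integral => w _.
  rewrite patchE indicE; case: (w \in B); first by rewrite mulr1 EFinM.
  by rewrite mulr0 mul0r.
rewrite (restrict (fun w => f (a w))) restrict; congr fine.
rewrite (@ge0_disintegration _ _ _ _ _ _ _ P G B a h k _ _ _ _ law X
  (fun e => (f e)%:E))//.
- by apply: eq_integral => w _; rewrite (meanE (pker_setT k (h w)) bf).
- by apply/measurable_EFinP; case: bf.
Qed.

End kernel_mean.

(** * Expectations under policies that depend on the state only *)

Section clip.
Context {R : realType}.
Implicit Types M v : R.

Definition clip M v := Num.max 0 (Num.min v M).

Lemma clip_itv M v : 0 <= M -> 0 <= clip M v <= M.
Proof. by move=> M0; rewrite /clip le_max lexx ge_max M0 ge_min lexx orbT. Qed.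

Lemma clip_id M v : 0 <= v <= M -> clip M v = v.
Proof. by move=> /andP[v0 vM]; rewrite /clip min_l// max_r. Qed.

Lemma bounded_mfun_clip M : 0 <= M -> bounded_mfun (clip M).
Proof.
move=> M0; apply: (bounded_mfun_itv (a := 0) (b := M)); last first.
  by move=> v; exact: clip_itv.
by apply: measurable_maxr => //; exact: measurable_minr.
Qed.

End clip.

Section policies.
Context {R : realType} {dY : measure_display} {Y : measurableType dY}.
Variables (smax gmax amax xmax pmax : R).
Variables (A : R.-pker (R * Y * R)%type ~> R) (F : R -> Y -> R -> R).
Hypotheses (smax_ge0 : 0 <= smax) (gmax_ge0 : 0 <= gmax).
Hypotheses (amax_ge0 : 0 <= amax) (xmax_ge0 : 0 <= xmax) (pmax_ge0 : 0 <= pmax).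
Hypothesis demand : demand_model A F gmax amax pmax.

Notation state := (R * Y * R)%type.
Notation decision := (R * bool * R)%type.

(** The mean of the demand kernel, which is the demand function [F] at admissible
    prices. Clipping the integrand makes it bounded and jointly measurable at
    all arguments, neither of which is known of [F]. *)
Definition mean_demand (e : R * Y * R) : R := \int[A e]_c clip amax c.

Lemma mean_demand_itv e : 0 <= mean_demand e <= amax.
Proof.
apply: (mean_itv (pker_setT A e)); first exact: bounded_mfun_clip.
by move=> c; exact: clip_itv.
Qed.

Lemma bounded_mfun_mean_demand : bounded_mfun mean_demand.
Proof.
apply: (@bounded_mfun_kernel_mean _ _ _ _ _ A (fun x => clip amax x.2)).
exact: (bounded_mfun_comp measurable_snd (bounded_mfun_clip amax_ge0)).
Qed.

Lemma integral_demand_affine p y g (alpha beta : R) :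
  0 <= p <= pmax -> 0 <= g <= gmax ->
  (\int[A (p, y, g)]_c (alpha * c + beta)%:E =
   (alpha * mean_demand (p, y, g) + beta)%:E)%E.
Proof.
move=> hp hg; have [A1 _] := proj1 demand p y g hp hg.
have mI : measurable (`[0, amax] : set R) by exact: measurable_itv.
have bc := bounded_mfun_clip amax_ge0.
rewrite (eq_integral_full mI (full_setC (pker_setT A _) mI A1)
  (g := fun c => (alpha * clip amax c + beta)%:E)); last first.
  by move=> c; rewrite /= in_itv/= => hc; rewrite clip_id.
rewrite (meanE (pker_setT A _)); last by bounded.
rewrite (meanD (pker_setT A _)); [|by bounded..].
by rewrite (meanZ (pker_setT A _))// (mean_cst (pker_setT A _)).
Qed.

Lemma mean_demandE p y g : 0 <= p <= pmax -> 0 <= g <= gmax ->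
  F p y g = mean_demand (p, y, g).
Proof.
move=> hp hg; have [_ FE] := proj1 demand p y g hp hg.
apply: EFin_inj; rewrite -FE -[in RHS](mul1r (mean_demand _)).
rewrite -[in RHS](addr0 (1 * _)) -integral_demand_affine//.
by apply: eq_integral => c _; rewrite mul1r addr0.
Qed.

Definition good_state : set state :=
  [set z | 0 <= z.1.1 <= smax /\ 0 <= z.2 <= gmax].

Definition good_decision : set decision :=
  [set u | 0 <= u.1.1 <= xmax /\ 0 <= u.2 <= pmax].

Lemma measurable_between d (T : measurableType d) (f g : T -> R) a b :
  measurable_fun setT f -> measurable_fun setT g -> forall a' b',
  measurable [set x | a <= f x <= b /\ a' <= g x <= b'].
Proof.
move=> mf mg a' b'.
rewrite [X in measurable X](_ : _ = f @^-1` `[a, b] `&` g @^-1` `[a', b']).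
  by apply: measurableI; rewrite -[X in measurable X]setTI;
    [apply: mf|apply: mg].
by apply/seteqP; split => x /=; rewrite !in_itv.
Qed.

Lemma measurable_good_state : measurable good_state.
Proof.
apply: (measurable_between (f := fun z : state => z.1.1) (g := snd)) => //.
exact: (measurableT_comp measurable_fst measurable_fst).
Qed.

Lemma measurable_good_decision : measurable good_decision.
Proof.
apply: (measurable_between (f := fun u : decision => u.1.1) (g := snd)) => //.
exact: (measurableT_comp measurable_fst measurable_fst).
Qed.

(** Versions of the quantities of one slot, in terms of its state and decision,
    that are bounded everywhere and exact at good states and decisions. *)
Definition supply_of (z : state) : R := clip smax z.1.1.

Definition requests_of (x : state * decision) : R :=
  x.2.1.2%:R * mean_demand (x.2.2, x.1.1.2, x.1.2).

Definition revenue_of (x : state * decision) : R :=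
  clip pmax x.2.2 * requests_of x.

Definition outside_of (x : state * decision) : R := clip xmax x.2.1.1.

Definition cost_of (x : state * decision) : R :=
  clip gmax x.1.2 * outside_of x.

Lemma bounded_mfun_bool d (T : measurableType d) (b : T -> bool) :
  measurable_fun setT b -> bounded_mfun (fun x => (b x)%:R : R).
Proof.
move=> mb; apply: (bounded_mfun_itv (a := 0) (b := 1)); last first.
  by move=> x; case: (b x); rewrite ?lexx ?ler01.
by apply: (measurableT_comp (f := fun c : bool => c%:R : R)) mb.
Qed.

Lemma bounded_mfun_supply_of : bounded_mfun supply_of.
Proof.
apply: (bounded_mfun_comp (h := fun z : state => z.1.1)).
  exact: (measurableT_comp measurable_fst measurable_fst).
exact: bounded_mfun_clip.
Qed.

Lemma bounded_mfun_requests_of : bounded_mfun requests_of.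
Proof.
apply: bounded_mfunM.
  apply: (bounded_mfun_bool (b := fun x : state * decision => x.2.1.2)).
  apply: (measurableT_comp measurable_snd).
  exact: (measurableT_comp measurable_fst measurable_snd).
apply: (bounded_mfun_comp
  (h := fun x : state * decision => (x.2.2, x.1.1.2, x.1.2))); last first.
  exact: bounded_mfun_mean_demand.
apply: measurable_fun_pair; last first.
  exact: (measurableT_comp measurable_snd measurable_fst).
apply: measurable_fun_pair.
  exact: (measurableT_comp measurable_snd measurable_snd).
apply: (measurableT_comp measurable_snd).
exact: (measurableT_comp measurable_fst measurable_fst).
Qed.

Lemma bounded_mfun_revenue_of : bounded_mfun revenue_of.
Proof.
apply: bounded_mfunM; last exact: bounded_mfun_requests_of.
apply: (bounded_mfun_comp (h := fun x : state * decision => x.2.2)).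
  exact: (measurableT_comp measurable_snd measurable_snd).
exact: bounded_mfun_clip.
Qed.

Lemma bounded_mfun_outside_of : bounded_mfun outside_of.
Proof.
apply: (bounded_mfun_comp (h := fun x : state * decision => x.2.1.1)).
  apply: (measurableT_comp measurable_fst).
  exact: (measurableT_comp measurable_fst measurable_snd).
exact: bounded_mfun_clip.
Qed.

Lemma bounded_mfun_cost_of : bounded_mfun cost_of.
Proof.
apply: bounded_mfunM; last exact: bounded_mfun_outside_of.
apply: (bounded_mfun_comp (h := fun x : state * decision => x.1.2)).
  exact: (measurableT_comp measurable_snd measurable_fst).
exact: bounded_mfun_clip.
Qed.

Section policy.
Variable pi : R.-pker state ~> decision.

Definition policy_mean (f : state * decision -> R) (z : state) : R :=
  \int[pi z]_u f (z, u).

Lemma bounded_mfun_policy_mean f : bounded_mfun f ->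
  bounded_mfun (policy_mean f).
Proof. exact: bounded_mfun_kernel_mean. Qed.

Lemma bounded_mfun_slice (f : state * decision -> R) z : bounded_mfun f ->
  bounded_mfun (fun u => f (z, u)).
Proof.
by move=> [mf [M fM]]; split; [exact: measurable_fun_pair2|exists M].
Qed.

Variable mu : probability state R.
Hypotheses (mu_good : mu good_state = 1%E) (feasible : feasible_policy xmax pmax pi).

(** The state and the decision are good almost surely, so the integrand may be
    replaced by any bounded measurable function that agrees with it there. *)
Lemma policy_expectationE (g : state -> decision -> R -> R)
    (f : state * decision -> R) : bounded_mfun f ->
  (forall z u, good_state z -> good_decision u ->
     (if u.1.2 then \int[A (u.2, z.1.2, z.2)]_c (g z u c)%:E
      else (g z u 0)%:E)%E = (f (z, u))%:E) ->
  policy_expectation A mu pi g = (\int[mu]_z policy_mean f z)%:E.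
Proof.
move=> bf gf; rewrite -(meanE (probability_setT mu)); last first.
  exact: bounded_mfun_policy_mean.
apply: (eq_integral_full measurable_good_state).
  exact: (full_setC (probability_setT mu) measurable_good_state).
move=> z zgood; rewrite -(meanE (pker_setT pi z) (bounded_mfun_slice z bf)).
apply: (eq_integral_full measurable_good_decision).
  exact: (full_setC (pker_setT pi z) measurable_good_decision (feasible z)).
by move=> u ugood; exact: gf.
Qed.

Lemma policy_expectation_profit : policy_expectation A mu pi
    (fun z u c => u.1.2%:R * u.2 * c - z.2 * u.1.1) =
  (\int[mu]_z policy_mean revenue_of z - \int[mu]_z policy_mean cost_of z)%:E.
Proof.
rewrite (policy_expectationE (f := fun x => revenue_of x - cost_of x)); last 2 first.
- apply: bounded_mfunD; first exact: bounded_mfun_revenue_of.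
  by apply: bounded_mfunN; exact: bounded_mfun_cost_of.
- move=> [[s y] g] [[x b] p] [/= hs hg] [/= hx hp].
  rewrite /revenue_of /cost_of /outside_of /requests_of /= !clip_id//.
  case: b; rewrite /= ?mul0r ?mulr0 ?mul1r ?mulr1//.
  by rewrite integral_demand_affine.
congr EFin; rewrite -(meanB (probability_setT mu)).
- apply: eq_Rintegral => z _; apply: (meanB (pker_setT pi z));
    apply: bounded_mfun_slice; [exact: bounded_mfun_revenue_of|].
  exact: bounded_mfun_cost_of.
- by apply: bounded_mfun_policy_mean; exact: bounded_mfun_revenue_of.
- by apply: bounded_mfun_policy_mean; exact: bounded_mfun_cost_of.
Qed.

Lemma policy_expectation_requests : policy_expectation A mu pi (fun _ _ c => c) =
  (\int[mu]_z policy_mean requests_of z)%:E.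
Proof.
apply: policy_expectationE; first exact: bounded_mfun_requests_of.
move=> [[s y] g] [[x b] p] [/= hs hg] [/= hx hp].
rewrite /requests_of; case: b; rewrite /= ?mul0r ?mul1r//.
have := @integral_demand_affine p y g 1 0 hp hg; rewrite mul1r addr0 => <-.
by apply: eq_integral => c _; rewrite mul1r addr0.
Qed.

Lemma policy_expectation_drift : policy_expectation A mu pi
    (fun z u c => (c - z.1.1 - u.1.1)%R) =
  (\int[mu]_z policy_mean requests_of z - \int[mu]_z supply_of z
   - \int[mu]_z policy_mean outside_of z)%:E.
Proof.
have br := bounded_mfun_requests_of; have bx := bounded_mfun_outside_of.
have bs := bounded_mfun_supply_of.
have bs2 : bounded_mfun (fun x : state * decision => supply_of x.1).
  exact: (bounded_mfun_comp measurable_fst bs).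
rewrite (policy_expectationE (f := fun x =>
  requests_of x - supply_of x.1 - outside_of x)); last 2 first.
- by bounded.
- move=> [[s y] g] [[x b] p] [/= hs hg] [/= hx hp].
  rewrite /requests_of /supply_of /outside_of /= !clip_id//.
  case: b; rewrite /= ?mul0r ?mul1r//.
  have := @integral_demand_affine p y g 1 (- s - x) hp hg.
  rewrite mul1r addrA => <-.
  by apply: eq_integral => c _; rewrite mul1r addrA.
have m1 := probability_setT mu.
congr EFin; rewrite -(meanB m1)//; [|exact: bounded_mfun_policy_mean].
rewrite -(meanB m1); [|bounded; exact: bounded_mfun_policy_mean
  |exact: bounded_mfun_policy_mean].
apply: eq_Rintegral => z _; have pz1 := pker_setT pi z.
have brz := bounded_mfun_slice z br; have bxz := bounded_mfun_slice z bx.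
rewrite /policy_mean /= (meanB pz1)//; last by bounded.
by rewrite (meanB pz1)//= ?(mean_cst pz1)//; exact: bounded_mfun_cst.
Qed.

End policy.

End policies.

(** * Comparison of the algorithm with a policy *)

Section max_weight.
Context {R : realType} {dY : measure_display} {Y : measurableType dY}.
Variables (smax gmax amax xmax pmax : R).
Variables (A : R.-pker (R * Y * R)%type ~> R) (F : R -> Y -> R -> R).
Hypotheses (smax_ge0 : 0 <= smax) (gmax_ge0 : 0 <= gmax).
Hypotheses (amax_ge0 : 0 <= amax) (xmax_ge0 : 0 <= xmax) (pmax_ge0 : 0 <= pmax).
Hypothesis demand : demand_model A F gmax amax pmax.

Notation state := (R * Y * R)%type.
Notation decision := (R * bool * R)%type.

Let bounded_requests := @bounded_mfun_requests_of R dY Y amax A amax_ge0.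
Let bounded_revenue := @bounded_mfun_revenue_of R dY Y amax pmax A amax_ge0 pmax_ge0.
Let bounded_outside := @bounded_mfun_outside_of R dY Y xmax xmax_ge0.
Let bounded_cost := @bounded_mfun_cost_of R dY Y gmax xmax gmax_ge0 xmax_ge0.

(** The price rule maximizes the first term on the right, the value [0] of
    rejecting being available, and the purchase rule minimizes the term
    subtracted. So the algorithm does at least as well as each admissible
    decision, hence as their average under [pi]. *)
Lemma max_weight (pi : R.-pker state ~> decision) V q l s y g p b x :
  feasible_policy xmax pmax pi ->
  0 <= s <= smax -> 0 <= g <= gmax -> 0 <= p <= pmax ->
  let value p' := F p' y g * (V * p' - q) in
  (forall p', 0 <= p' <= pmax -> value p' <= value p) ->
  b = (0 <= value p) ->
  x = (if q + l <= V * g then 0 else xmax) ->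
  V * policy_mean pi (revenue_of amax pmax A) (s, y, g)
  - q * policy_mean pi (requests_of amax A) (s, y, g)
  - V * policy_mean pi (cost_of gmax xmax) (s, y, g)
  + (q + l) * policy_mean pi (outside_of xmax) (s, y, g) <=
  b%:R * mean_demand amax A (p, y, g) * (V * p - q) - x * (V * g - q - l).
Proof.
move=> feasible hs hg hp value pmaximal bE xE; set z := (s, y, g).
have pz1 := pker_setT pi z.
have b1 := bounded_mfun_slice z bounded_requests.
have b2 := bounded_mfun_slice z bounded_revenue.
have b3 := bounded_mfun_slice z bounded_outside.
have b4 := bounded_mfun_slice z bounded_cost.
rewrite /policy_mean -!(meanZ pz1)//.
rewrite -(meanB pz1); [|by bounded..].
rewrite -(meanB pz1); [|by bounded..].
rewrite -(meanD pz1); [|by bounded..].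
rewrite -[leRHS](mean_cst pz1).
apply: (le_mean_full pz1 (@measurable_good_decision _ xmax pmax) (feasible z)).
- by bounded.
- exact: bounded_mfun_cst.
move=> [[x' b'] p'] [/= hx' hp'].
rewrite /revenue_of /cost_of /outside_of /requests_of /z /= !clip_id//.
have price_part : b'%:R * mean_demand amax A (p', y, g) * (V * p' - q) <=
    b%:R * mean_demand amax A (p, y, g) * (V * p - q).
  have le_p := pmaximal p' hp'.
  rewrite /value !(mean_demandE amax_ge0 demand)// in le_p.
  rewrite bE /value (mean_demandE amax_ge0 demand)//.
  by case: b'; have [|] := leP 0 (mean_demand amax A (p, y, g) * (V * p - q));
    rewrite ?mul1r ?mul0r//; lra.
have outside_part : x * (V * g - q - l) <= x' * (V * g - q - l).
  rewrite xE; have [low|high] := leP (q + l) (V * g).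
    by rewrite mul0r mulr_ge0//; [case/andP: hx'|lra].
  by rewrite ler_wnM2r//; [lra|case/andP: hx'].
by move: price_part outside_part; lra.
Qed.

(** If [eps] is at most the mean supply, every optimal policy will do. Otherwise
    some optimal policy has mean requests within [delta] of the supremum
    [a_star], and its mean service is at least its mean requests. The slack
    [delta] is there because the supremum may not be attained. *)
Lemma near_optimal_policy (mu : probability state R) eps delta :
  mu (good_state smax gmax) = 1%E -> 0 < delta ->
  (exists pi, optimal_policy A mu smax gmax amax xmax pmax pi) ->
  (eps%:E <= maxe (a_star A mu smax gmax amax xmax pmax)%:E
                  (\int[mu]_z supply_of smax z)%:E)%E ->
  exists2 pi, optimal_policy A mu smax gmax amax xmax pmax pi &
    eps <= \int[mu]_z supply_of smax z
           + \int[mu]_z policy_mean pi (outside_of xmax) z + delta.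
Proof.
move=> mu_good delta0 [pi0 opt0] eps_le.
have requestsE pi : optimal_policy A mu smax gmax amax xmax pmax pi ->
    policy_expectation A mu pi (fun _ _ c => c) =
    (\int[mu]_z policy_mean pi (requests_of amax A) z)%:E.
  by move=> [feasible _ _]; exact: (policy_expectation_requests _ demand mu_good).
have outside_ge0 pi : 0 <= \int[mu]_z policy_mean pi (outside_of xmax) z.
  apply: Rintegral_ge0 => z _; apply: Rintegral_ge0 => u _.
  by have /andP[] := clip_itv u.1.1 xmax_ge0.
move: eps_le; rewrite le_max !lee_fin => /orP[eps_le|eps_le]; last first.
  by exists pi0 => //; have := outside_ge0 pi0; lra.
have [v [pi opt vE] v_large] : exists2 v,
    [set v | exists2 pi, optimal_policy A mu smax gmax amax xmax pmax pi &
      policy_expectation A mu pi (fun _ _ c => c) = v%:E] v &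
    a_star A mu smax gmax amax xmax pmax - delta < v.
  apply: sup_adherent => //; split.
    by eexists; exists pi0 => //; exact: requestsE.
  exists amax => v [pi opt]; rewrite requestsE// => -[<-].
  have /andP[_ //] : 0 <= \int[mu]_z policy_mean pi (requests_of amax A) z <= amax.
  apply: (mean_itv (probability_setT mu)).
    exact: bounded_mfun_policy_mean.
  move=> z; apply: (mean_itv (pker_setT pi z)).
    exact: bounded_mfun_slice.
  move=> u; rewrite /requests_of; case: (u.1.2); rewrite ?mul1r ?mul0r ?lexx//.
  exact: mean_demand_itv.
exists pi => //; have [feasible _ +] := opt.
rewrite (policy_expectation_drift smax_ge0 amax_ge0 xmax_ge0 demand mu_good)//.
rewrite lee_fin => drift_le0.
move: vE; rewrite requestsE// => -[vE].
by move: v_large eps_le drift_le0; rewrite vE; lra.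
Qed.

End max_weight.

(** * Measurability with respect to the past *)

Section filtration.
Context {R : realType} {dY : measure_display} {Y : measurableType dY}.
Context {d : measure_display} {T : measurableType d} {P : probability T R}.
Variable r : run Y P.

Definition decision_gen t : set_system T :=
  history_gen r t `|` preimage_set_system setT (before_requests r t) measurable.

Lemma measurable_fun_gen d' (S : measurableType d') (f : T -> S) (G : set_system T) :
  preimage_set_system setT f measurable `<=` <<s G >> ->
  measurable_fun setT (f : g_sigma_algebraType G -> S).
Proof. by move=> fG _ U mU; apply: fG; exists U. Qed.

Lemma measurable_fun_gen_le d' (S : measurableType d') (f : T -> S)
    (G G' : set_system T) : <<s G >> `<=` <<s G' >> ->
  measurable_fun setT (f : g_sigma_algebraType G -> S) ->
  measurable_fun setT (f : g_sigma_algebraType G' -> S).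
Proof. by move=> GG' mf _ U mU; apply: GG'; exact: (mf measurableT). Qed.

Lemma measurable_state t : measurable_fun setT (state_at r t).
Proof. by apply: measurable_fun_pair => //; exact: measurable_fun_pair. Qed.

Lemma measurable_before_requests t : measurable_fun setT (before_requests r t).
Proof.
apply: measurable_fun_pair; first exact: measurable_state.
by apply: measurable_fun_pair => //; exact: measurable_fun_pair.
Qed.

Lemma measurable_slot t : measurable_fun setT (slot r t).
Proof. by apply: measurable_fun_pair => //; exact: measurable_before_requests. Qed.

Lemma preimage_measurable d' (S : measurableType d') (f : T -> S) :
  measurable_fun setT f -> preimage_set_system setT f measurable `<=` measurable.
Proof. by move=> mf _ [U mU <-]; exact: mf. Qed.

Lemma history_gen_measurable t : history_gen r t `<=` measurable.
Proof.
by move=> H [tau _]; exact: (preimage_measurable (measurable_slot tau)).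
Qed.

Lemma history_measurable t : <<s history_gen r t >> `<=` measurable.
Proof.
apply: smallest_sub; first exact: sigma_algebra_measurable.
exact: history_gen_measurable.
Qed.

Lemma decision_history_measurable t : <<s decision_gen t >> `<=` measurable.
Proof.
apply: smallest_sub; first exact: sigma_algebra_measurable.
move=> H [|]; first exact: history_gen_measurable.
exact: (preimage_measurable (measurable_before_requests t)).
Qed.

Lemma history_sub_decision t : <<s history_gen r t >> `<=` <<s decision_gen t >>.
Proof. by apply: sub_smallest2r; [exact: smallest_sigma_algebra|left]. Qed.

Lemma slot_measurable_history n t : (t < n)%N ->
  measurable_fun setT (slot r t : g_sigma_algebraType (history_gen r n) -> _).
Proof.
move=> tn; apply: measurable_fun_gen => H HG.
by apply: sub_sigma_algebra; exists t.
Qed.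

Let past_supply n t : (t < n)%N -> measurable_fun setT
  (supply r t : g_sigma_algebraType (history_gen r n) -> R).
Proof.
move=> tn; apply: (measurableT_comp (f := fun x => x.1.1.1.1) _
  (slot_measurable_history tn)).
do 3![apply: (measurableT_comp measurable_fst) => //].
Qed.

Let past_outside n t : (t < n)%N -> measurable_fun setT
  (outside r t : g_sigma_algebraType (history_gen r n) -> R).
Proof.
move=> tn; apply: (measurableT_comp (f := fun x => x.1.2.1.1) _
  (slot_measurable_history tn)).
do 2![apply: (measurableT_comp measurable_fst) => //].
exact: (measurableT_comp measurable_snd measurable_fst).
Qed.

Let past_requests n t : (t < n)%N -> measurable_fun setT
  (requests r t : g_sigma_algebraType (history_gen r n) -> R).
Proof.
move=> tn; exact: (measurableT_comp (f := snd) measurable_snd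
  (slot_measurable_history tn)).
Qed.

(** The queues of slot [t] are functions of the slots before [t]; this is what
    makes them independent of the state of slot [t]. *)
Lemma Q_measurable_history n t : (t <= n)%N ->
  measurable_fun setT (Q r t : g_sigma_algebraType (history_gen r n) -> R).
Proof.
elim: t => [_|t IH tn]; first exact: measurable_cst.
apply: measurable_funD; last exact: past_requests.
apply: measurable_maxr => //; apply: measurable_funB; last exact: past_outside.
by apply: measurable_funB; [exact: IH (ltnW tn)|exact: past_supply].
Qed.

Lemma Z_measurable_history eps n t : (t <= n)%N ->
  measurable_fun setT (Z r eps t : g_sigma_algebraType (history_gen r n) -> R).
Proof.
elim: t => [_|t IH tn]; first exact: measurable_cst.
apply: measurable_maxr => //; apply: measurable_funD.
  apply: measurable_funB; last exact: past_outside.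
  by apply: measurable_funB; [exact: IH (ltnW tn)|exact: past_supply].
apply: measurable_funM => //.
apply: (measurableT_comp (f := fun c : bool => c%:R : R)) => //.
by apply: measurable_fun_ltr => //; exact: Q_measurable_history (ltnW tn).
Qed.

Lemma Q_measurable_decision t :
  measurable_fun setT (Q r t : g_sigma_algebraType (decision_gen t) -> R).
Proof.
exact: measurable_fun_gen_le (@history_sub_decision t)
  (Q_measurable_history (leqnn t)).
Qed.

Lemma price_measurable_decision t :
  measurable_fun setT (price r t : g_sigma_algebraType (decision_gen t) -> R).
Proof.
apply: (measurableT_comp (f := fun x => x.2.2)
  (measurableT_comp measurable_snd measurable_snd)
  (_ : measurable_fun setT
    (before_requests r t : g_sigma_algebraType (decision_gen t) -> _))).
by apply: measurable_fun_gen => H HG; apply: sub_sigma_algebra; right.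
Qed.

End filtration.

(** * Lyapunov drift *)

Section queue_squares.
Context {R : realType}.
Implicit Types q l c a e C eps : R.

(** The cross term [2 * a * max(q - c, 0)] is at most [2 * a * q], which leaves
    a drift linear in the queue. *)
Lemma sqr_queue_le q c a : 0 <= q -> 0 <= c -> 0 <= a ->
  (Num.max (q - c) 0 + a) ^+ 2 <= q ^+ 2 + c ^+ 2 + a ^+ 2 + 2 * q * (a - c).
Proof.
move=> q0 c0 a0; rewrite /Num.max; case: ifP => _.
  by have := sqr_ge0 (q - c); have := mulr_ge0 q0 a0; lra.
by have := mulr_ge0 a0 c0; lra.
Qed.

(** The increment [e - c] may have either sign, so its square is at most the
    larger of the two extreme squares; this is the maximum in [Bconst]. *)
Lemma sqr_virtual_queue_le l c e eps C : 0 <= l -> 0 <= e <= eps -> 0 <= c <= C ->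
  (Num.max (l - c + e) 0) ^+ 2 <=
  l ^+ 2 + Num.max (eps ^+ 2) (C ^+ 2) + 2 * l * (eps - c).
Proof.
move=> l0 /andP[e0 e1] /andP[c0 c1].
have jump : (e - c) ^+ 2 <= Num.max (eps ^+ 2) (C ^+ 2).
  rewrite le_max; apply/orP; have [ec|ce] := leP e c.
    by right; rewrite -sqrrN opprB ler_sqr ?nnegrE; lra.
  by left; rewrite ler_sqr ?nnegrE; lra.
move: jump; set M := Num.max (eps ^+ 2) _ => jump.
have := sqr_ge0 (l + (e - c)); have := ler_wpM2l l0 e1.
by rewrite /Num.max; case: ifP => _; lra.
Qed.

End queue_squares.

Section drift.
Context {R : realType} {dY : measure_display} {Y : measurableType dY}.
Variables (smax gmax amax xmax pmax eps V : R).
Variables (A : R.-pker (R * Y * R)%type ~> R) (F : R -> Y -> R -> R).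
Context {d : measure_display} {T : measurableType d} {P : probability T R}.
Variable r : run Y P.
Hypothesis demand : demand_model A F gmax amax pmax.
Hypothesis valid : valid_run A smax gmax amax xmax pmax r.
Hypotheses (amax_le : amax <= xmax) (eps_le : eps <= xmax).
Hypotheses (eps_ge0 : 0 <= eps) (V_gt0 : 0 < V).
Hypothesis jpa : joint_pricing_allocation F xmax pmax eps V r.

Let supply_bounds t w : 0 <= supply r t w <= smax.
Proof. by have [[+ _] _ _ _] := valid. Qed.

Let market_bounds t w : 0 <= market_price r t w <= gmax.
Proof. by have [[_ +] _ _ _] := valid. Qed.

Let outside_bounds t w : 0 <= outside r t w <= xmax.
Proof. by have [_ [+ _] _ _] := valid. Qed.

Let price_bounds t w : 0 <= price r t w <= pmax.
Proof. by have [_ [_ +] _ _] := valid. Qed.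

Let requests_bounds t w : 0 <= requests r t w <= amax.
Proof. by have [_ _ [+ _] _] := valid. Qed.

Let requests_accepted t w :
  requests r t w = (accept r t w)%:R * requests r t w.
Proof.
have [_ _ [_ rejected] _] := valid.
by case: (boolP (accept r t w)) => [_|/negbTE/rejected ->]; rewrite ?mul1r ?mulr0.
Qed.

Let outsideE t w : outside r t w =
  if Q r t w + Z r eps t w <= V * market_price r t w then 0 else xmax.
Proof. by have [] := jpa t w. Qed.

Let smax_ge0 : 0 <= smax.
Proof. by have /andP[ge0] := supply_bounds 0 point; exact: le_trans. Qed.
Let gmax_ge0 : 0 <= gmax.
Proof. by have /andP[ge0] := market_bounds 0 point; exact: le_trans. Qed.
Let amax_ge0 : 0 <= amax.
Proof. by have /andP[ge0] := requests_bounds 0 point; exact: le_trans. Qed.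
Let xmax_ge0 : 0 <= xmax.
Proof. by have /andP[ge0] := outside_bounds 0 point; exact: le_trans. Qed.
Let pmax_ge0 : 0 <= pmax.
Proof. by have /andP[ge0] := price_bounds 0 point; exact: le_trans. Qed.

Let Q_itv t w : 0 <= Q r t w <= Qmax V gmax amax.
Proof.
rewrite (@Q_ge0 _ _ _ _ _ _ r amax)//=.
by apply: (@Q_le _ _ _ _ _ _ r smax gmax amax xmax eps V).
Qed.

Let Z_itv t w : 0 <= Z r eps t w <= V * gmax + eps.
Proof.
rewrite Z_ge0/=.
by apply: (@Z_le _ _ _ _ _ _ r smax gmax amax xmax eps V).
Qed.

Let bounded_Q t : bounded_mfun (Q r t).
Proof.
apply: bounded_mfun_itv (Q_itv t).
exact: (measurable_fun_sub (history_measurable (t := t))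
  (Q_measurable_history (r := r) (leqnn t))).
Qed.

Let bounded_Z t : bounded_mfun (Z r eps t).
Proof.
apply: bounded_mfun_itv (Z_itv t).
exact: (measurable_fun_sub (history_measurable (t := t))
  (Z_measurable_history (r := r) eps (leqnn t))).
Qed.

Let bounded_supply t : bounded_mfun (supply r t).
Proof. exact: bounded_mfun_itv (supply_bounds t). Qed.
Let bounded_market t : bounded_mfun (market_price r t).
Proof. exact: bounded_mfun_itv (market_bounds t). Qed.
Let bounded_outside t : bounded_mfun (outside r t).
Proof. exact: bounded_mfun_itv (outside_bounds t). Qed.
Let bounded_price t : bounded_mfun (price r t).
Proof. exact: bounded_mfun_itv (price_bounds t). Qed.
Let bounded_requests t : bounded_mfun (requests r t).
Proof. exact: bounded_mfun_itv (requests_bounds t). Qed.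
Let bounded_accept t : bounded_mfun (fun w => (accept r t w)%:R : R).
Proof. exact: bounded_mfun_bool. Qed.

Let demand_at t w :=
  mean_demand amax A (price r t w, demand_state r t w, market_price r t w).

Let measurable_demand_arg t : measurable_fun setT
  (fun w => (price r t w, demand_state r t w, market_price r t w)).
Proof. by apply: measurable_fun_pair => //; exact: measurable_fun_pair. Qed.

Let bounded_demand_at t : bounded_mfun (demand_at t).
Proof.
apply: (bounded_mfun_comp (measurable_demand_arg t)).
exact: bounded_mfun_mean_demand.
Qed.

Lemma bounded_mfun_profit t : bounded_mfun (profit r t).
Proof. by rewrite /profit; bounded. Qed.

(** Averaging over the arrivals of slot [t] alone, with everything decided before
    them held fixed. *)
Lemma mean_requests_weighted t (X : T -> R) : (forall w, 0 <= X w) ->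
  measurable_fun setT (X : g_sigma_algebraType (decision_gen r t) -> R) ->
  \int[P]_w (X w * requests r t w) =
  \int[P]_w (X w * (accept r t w)%:R * demand_at t w).
Proof.
move=> X0 mX; have [_ _ _ law] := valid.
have indicE' w : \1_(accept r t @^-1` [set true]) w = (accept r t w)%:R :> R.
  rewrite indicE; congr ((nat_of_bool _)%:R); apply/idP/idP => [/set_mem//|acc].
  exact/mem_set.
have mB : measurable (accept r t @^-1` [set true]).
  by rewrite -[X in measurable X]setTI; exact: measurable_funP.
transitivity (\int[P]_w (X w * \1_(accept r t @^-1` [set true]) w *
    clip amax (requests r t w))).
  apply: eq_Rintegral => w _; rewrite indicE' clip_id//.
  by rewrite [in LHS]requests_accepted mulrA.
rewrite (mean_disintegration (G := decision_gen r t)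
  (h := fun w => (price r t w, demand_state r t w, market_price r t w)) (k := A))//.
- by apply: eq_Rintegral => w _; rewrite indicE'.
- exact: decision_history_measurable.
- exact: law.
- by move=> c; have /andP[] := clip_itv c amax_ge0.
- exact: bounded_mfun_clip.
Qed.

Section iid.
Variable mu : probability (R * Y * R)%type R.
Hypothesis iid : iid_states mu r.

Lemma mean_state_weighted t (X : T -> R) (f : R * Y * R -> R) :
  (forall w, 0 <= X w) -> bounded_mfun X ->
  measurable_fun setT (X : g_sigma_algebraType (history_gen r t) -> R) ->
  (forall z, 0 <= f z) -> bounded_mfun f ->
  \int[P]_w (X w * f (state_at r t w)) = \int[P]_w X w * \int[mu]_z f z.
Proof.
move=> X0 bX mX f0 bf; have [same_law indep] := iid.
pose k := kprobability (measurable_cst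
  (mu : pprobability (R * Y * R)%type R) : measurable_fun [set: unit] _).
transitivity (\int[P]_w (X w * \1_(@setT T) w * f (state_at r t w))).
  by apply: eq_Rintegral => w _; rewrite indicT mulr1.
rewrite (mean_disintegration (G := history_gen r t)
  (h := fun=> tt) (k := k))//.
- transitivity (\int[P]_w ((\int[mu]_z f z) * X w)).
    by apply: eq_Rintegral => w _; rewrite indicT mulr1 mulrC.
  by rewrite (meanZ (probability_setT P))// mulrC.
- exact: history_measurable.
- exact: measurable_state.
- move=> H U GH mU; rewrite setIT indep// same_law//.
  by rewrite integral_cst//= 1?muleC//; exact: history_measurable GH.
Qed.

Lemma mean_state t (f : R * Y * R -> R) : (forall z, 0 <= f z) ->
  bounded_mfun f -> \int[P]_w f (state_at r t w) = \int[mu]_z f z.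
Proof.
move=> f0 bf; rewrite -[RHS]mul1r -[in RHS](mean_cst (probability_setT P) 1).
rewrite -(@mean_state_weighted t)//.
  by under [RHS]eq_Rintegral do rewrite mul1r.
exact: bounded_mfun_cst.
Qed.

Lemma good_state_full : mu (good_state smax gmax) = 1%E.
Proof.
have [same_law _] := iid.
rewrite -(same_law 0 _ (measurable_good_state _ _)).
rewrite (_ : _ @^-1` _ = setT) ?probability_setT//.
by apply/seteqP; split => // w _; split => /=.
Qed.

Definition lyapunov t w : R := (Q r t w ^+ 2 + Z r eps t w ^+ 2) / 2.

Lemma bounded_mfun_lyapunov t : bounded_mfun (lyapunov t).
Proof. by rewrite /lyapunov; bounded. Qed.

Lemma lyapunov_drift t w :
  lyapunov t.+1 w - lyapunov t w <= Bconst smax xmax amax eps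
  + Q r t w * (requests r t w - supply r t w - outside r t w)
  + Z r eps t w * (eps - supply r t w - outside r t w).
Proof.
have /andP[s0 s1] := supply_bounds t w; have /andP[x0 x1] := outside_bounds t w.
have /andP[a0 a1] := requests_bounds t w.
have /andP[q0 _] := Q_itv t w; have /andP[l0 _] := Z_itv t w.
have c0 : 0 <= supply r t w + outside r t w by lra.
have cC : supply r t w + outside r t w <= smax + xmax by lra.
have e01 : 0 <= eps * (0 < Q r t w)%R%:R <= eps.
  by case: (0 < Q r t w)%R; rewrite ?mulr1 ?mulr0 ?lexx ?eps_ge0.
have := sqr_queue_le q0 c0 a0.
have := sqr_virtual_queue_le l0 e01 (_ : 0 <= _ <= smax + xmax).
move=> /(_ (supply r t w + outside r t w)); rewrite c0 cC => /(_ isT).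
have : (supply r t w + outside r t w) ^+ 2 <= (smax + xmax) ^+ 2.
  by rewrite ler_sqr ?nnegrE; lra.
have : requests r t w ^+ 2 <= amax ^+ 2 by rewrite ler_sqr ?nnegrE; lra.
rewrite /lyapunov /Bconst Q_recE Z_recE !opprD !addrA.
by lra.
Qed.

(** Taking expectations in [lyapunov_drift] and replacing the requests by their
    conditional mean, the right-hand side contains exactly the expression that
    [max_weight] bounds by the same expression for [pi]. The state is independent
    of the queues, so the latter splits into products of means. There the factor
    of the mean of [Q] is the drift of [pi], which is at most [0], and the factor
    of the mean of [Z] is at most [delta]. *)
Lemma mean_drift t (pi : R.-pker (R * Y * R)%type ~> (R * bool * R)%type) delta :
  optimal_policy A mu smax gmax amax xmax pmax pi -> 0 <= delta ->
  eps <= \int[mu]_z supply_of smax z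
         + \int[mu]_z policy_mean pi (outside_of xmax) z + delta ->
  \int[P]_w lyapunov t.+1 w - \int[P]_w lyapunov t w
    - V * \int[P]_w profit r t w <=
  Bconst smax xmax amax eps - V * phi_star A mu smax gmax amax xmax pmax
  + (V * gmax + eps) * delta.
Proof.
move=> [feasible + +] delta0 eps_small.
rewrite (policy_expectation_profit gmax_ge0 amax_ge0 xmax_ge0 pmax_ge0 demand
  good_state_full feasible) => -[<-].
rewrite (policy_expectation_drift smax_ge0 amax_ge0 xmax_ge0 demand
  good_state_full feasible) lee_fin => drift_le0.
have P1 := probability_setT P.
pose rev := policy_mean pi (revenue_of amax pmax A).
pose req := policy_mean pi (requests_of amax A).
pose cost := policy_mean pi (cost_of gmax xmax).
pose out := policy_mean pi (outside_of xmax).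
pose st := state_at r t.
have brev : bounded_mfun rev.
  by apply: bounded_mfun_policy_mean; exact: bounded_mfun_revenue_of.
have breq : bounded_mfun req.
  by apply: bounded_mfun_policy_mean; exact: bounded_mfun_requests_of.
have bcost : bounded_mfun cost.
  by apply: bounded_mfun_policy_mean; exact: bounded_mfun_cost_of.
have bout : bounded_mfun out.
  by apply: bounded_mfun_policy_mean; exact: bounded_mfun_outside_of.
have bsup : bounded_mfun (@supply_of R dY Y smax) by exact: bounded_mfun_supply_of.
have bst f : bounded_mfun f -> bounded_mfun (fun w => f (st w)).
  by apply: bounded_mfun_comp; exact: measurable_state.
have [brev' breq' bcost' bout' bsup'] : [/\ bounded_mfun (fun w => rev (st w)),
    bounded_mfun (fun w => req (st w)), bounded_mfun (fun w => cost (st w)),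
    bounded_mfun (fun w => out (st w)) &
    bounded_mfun (fun w => supply_of smax (st w))] by split; exact: bst.
have clip0 M v : 0 <= M -> 0 <= clip M v by move=> /(clip_itv v)/andP[].
have dem0 e : 0 <= mean_demand amax A e.
  by have /andP[] := @mean_demand_itv _ _ _ _ A amax_ge0 e.
have req_of0 z : 0 <= requests_of amax A z by rewrite mulr_ge0.
have rev0 z : 0 <= rev z.
  by apply: Rintegral_ge0 => u _; rewrite mulr_ge0// clip0.
have req0 z : 0 <= req z by apply: Rintegral_ge0.
have out0 z : 0 <= out z by apply: Rintegral_ge0 => u _; exact: clip0.
have cost0 z : 0 <= cost z.
  by apply: Rintegral_ge0 => u _; rewrite mulr_ge0// clip0.
have sup0 z : 0 <= @supply_of R dY Y smax z by exact: clip0.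
have q0 w : 0 <= Q r t w by have /andP[] := Q_itv t w.
have l0 w : 0 <= Z r eps t w by have /andP[] := Z_itv t w.
have p0 w : 0 <= price r t w by have /andP[] := price_bounds t w.
have mQ := @Q_measurable_history _ _ _ _ _ _ r t t (leqnn t).
have mZ := @Z_measurable_history _ _ _ _ _ _ r eps t t (leqnn t).
have [blyap blyap' bprofit] : [/\ bounded_mfun (lyapunov t),
    bounded_mfun (lyapunov t.+1) & bounded_mfun (profit r t)].
  by split; [exact: bounded_mfun_lyapunov..|exact: bounded_mfun_profit].
pose common w := Bconst smax xmax amax eps + eps * Z r eps t w
  - (Q r t w + Z r eps t w) * (supply r t w + outside r t w)
  + V * (market_price r t w * outside r t w).
have bcommon : bounded_mfun common by rewrite /common; bounded.
have bqa : bounded_mfun (fun w => Q r t w * requests r t w) by bounded.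
have bpa : bounded_mfun (fun w => price r t w * requests r t w) by bounded.
have bqm : bounded_mfun
  (fun w => Q r t w * (accept r t w)%:R * demand_at t w) by bounded.
have bpm : bounded_mfun
  (fun w => price r t w * (accept r t w)%:R * demand_at t w) by bounded.
have step1 : \int[P]_w lyapunov t.+1 w - \int[P]_w lyapunov t w
      - V * \int[P]_w profit r t w <=
    \int[P]_w (Q r t w * requests r t w
      + (- V) * (price r t w * requests r t w) + common w).
  rewrite -(meanB P1)// -(meanZ P1)// -(meanB P1)//; [|by bounded..].
  apply: (le_mean P1); [by bounded..|] => w.
  have := lyapunov_drift t w; rewrite /profit /common.
  have -> : (accept r t w)%:R * price r t w * requests r t w =
      price r t w * requests r t w.
    by rewrite mulrAC -requests_accepted mulrC.
  by lra.
apply: (le_trans step1).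
(* the conditional law of the requests turns them into the mean demand *)
have -> : \int[P]_w (Q r t w * requests r t w
      + (- V) * (price r t w * requests r t w) + common w) =
    \int[P]_w (Q r t w * (accept r t w)%:R * demand_at t w
      + (- V) * (price r t w * (accept r t w)%:R * demand_at t w) + common w).
  rewrite (meanDZD P1 _ bqa bpa bcommon) (meanDZD P1 _ bqm bpm bcommon).
  rewrite mean_requests_weighted//; last exact: Q_measurable_decision.
  by rewrite mean_requests_weighted//; exact: price_measurable_decision.
have step2 : \int[P]_w (Q r t w * (accept r t w)%:R * demand_at t w
      + (- V) * (price r t w * (accept r t w)%:R * demand_at t w) + common w) <=
    \int[P]_w (Bconst smax xmax amax eps + eps * Z r eps t w
      + (-1) * (Q r t w * supply_of smax (st w))
      + (-1) * (Z r eps t w * supply_of smax (st w))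
      + (- V) * rev (st w) + Q r t w * req (st w) + V * cost (st w)
      + (-1) * (Q r t w * out (st w)) + (-1) * (Z r eps t w * out (st w))).
  apply: (le_mean P1); [by bounded..|] => w.
  have [hp pmaximal acceptE outE] := jpa t w.
  have := max_weight gmax_ge0 amax_ge0 xmax_ge0 pmax_ge0 demand (V := V)
    (l := Z r eps t w) feasible (supply_bounds t w)
    (market_bounds t w) hp pmaximal acceptE outE.
  rewrite -/rev -/req -/cost -/out -/(state_at r t w) -/(st w).
  have -> : supply_of smax (st w) = supply r t w.
    exact: clip_id (supply_bounds t w).
  by rewrite /common /demand_at; lra.
apply: (le_trans step2).
rewrite !(meanD P1); [|by bounded..].
rewrite !(meanZ P1); [|by bounded..].
rewrite (mean_cst P1) !mean_state// !(mean_state_weighted (t := t))//.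
have EQ0 : 0 <= \int[P]_w Q r t w by exact: Rintegral_ge0.
have EZ0 : 0 <= \int[P]_w Z r eps t w by exact: Rintegral_ge0.
have /andP[_ EZ1] := mean_itv P1 (bounded_Z t) (Z_itv t).
have := ler_wpM2l EQ0 drift_le0; have := ler_wpM2l EZ0 eps_small.
have := ler_wpM2r delta0 EZ1.
rewrite -/rev -/req -/cost -/out -/(Bconst smax xmax amax eps).
move: (Bconst _ _ _ _) (\int[P]_w Q r t w) (\int[P]_w Z r eps t w)
  (\int[mu]_z supply_of smax z) (\int[mu]_z out z) (\int[mu]_z req z)
  (\int[mu]_z rev z) (\int[mu]_z cost z) => B q l s o a p c.
by lra.
Qed.

(** The drifts of the successive slots telescope from a zero start to a
    non-negative end; then [delta] tends to [0]. *)
Lemma mean_profit_ge t :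
  (exists pi, optimal_policy A mu smax gmax amax xmax pmax pi) ->
  (eps%:E <= maxe (a_star A mu smax gmax amax xmax pmax)%:E
                  'E_P[supply r 0])%E ->
  t%:R * (V * phi_star A mu smax gmax amax xmax pmax - Bconst smax xmax amax eps)
  <= V * \sum_(tau < t) \int[P]_w profit r tau w.
Proof.
set phi := phi_star _ _ _ _ _ _ _; set B := Bconst _ _ _ _.
move=> opt eps_small.
have supplyE : 'E_P[supply r 0]%E = (\int[mu]_z supply_of smax z)%:E.
  rewrite expectation.unlock (meanE (probability_setT P) (bounded_supply 0)).
  congr EFin; rewrite -(@mean_state 0).
  - by apply: eq_Rintegral => w _; rewrite /supply_of clip_id// supply_bounds.
  - by move=> z; have /andP[] := clip_itv z.1.1 smax_ge0.
  - exact: bounded_mfun_supply_of.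
rewrite {}supplyE in eps_small.
have approx delta : 0 < delta -> t%:R * (V * phi - B) <=
    V * \sum_(tau < t) \int[P]_w profit r tau w
    + t%:R * (V * gmax + eps) * delta.
  move=> delta0; have [pi pi_opt pi_eps] := near_optimal_policy smax_ge0
    amax_ge0 xmax_ge0 demand good_state_full delta0 opt eps_small.
  suff : t%:R * (V * phi - B) + \int[P]_w lyapunov t w <=
      V * \sum_(tau < t) \int[P]_w profit r tau w
      + t%:R * (V * gmax + eps) * delta.
    apply: le_trans; rewrite lerDl; apply: Rintegral_ge0 => w _.
    by rewrite /lyapunov divr_ge0// addr_ge0// sqr_ge0.
  elim: t => [|n IH].
    have -> : \int[P]_w lyapunov 0 w = 0.
      rewrite -[RHS](mean_cst (probability_setT P) 0).
      by apply: eq_Rintegral => w _; rewrite /lyapunov /= expr0n addr0 mul0r.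
    by rewrite big_ord0 !mul0r mulr0 !addr0.
  have := mean_drift n pi_opt (ltW delta0) pi_eps.
  rewrite big_ord_recr/= -natr1 -/phi -/B mulrDr.
  by move: IH; lra.
apply/ler_addgt0Pr => e e0.
(* one is added to the denominator so that it is positive even when
   [t * (V * gmax + eps)] vanishes *)
have c0 : 0 <= t%:R * (V * gmax + eps).
  by rewrite mulr_ge0// addr_ge0// mulr_ge0// ltW.
have := approx (e / (t%:R * (V * gmax + eps) + 1)) (divr_gt0 e0 (ltr_pwDr ltr01 c0)).
move=> /le_trans; apply; rewrite lerD2l mulrCA ler_piMr ?(ltW e0)//.
by rewrite ler_pdivrMr ?mul1r ?lerDl// ltr_pwDr.
Qed.

Lemma time_average_profit_ge t : (0 < t)%N ->
  (exists pi, optimal_policy A mu smax gmax amax xmax pmax pi) ->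
  (eps%:E <= maxe (a_star A mu smax gmax amax xmax pmax)%:E
                  'E_P[supply r 0])%E ->
  ((phi_star A mu smax gmax amax xmax pmax - Bconst smax xmax amax eps / V)%:E
   <= time_average P (profit r) t)%E.
Proof.
move=> t0 opt eps_small; have := mean_profit_ge t opt eps_small.
have -> : time_average P (profit r) t =
    (t%:R^-1 * \sum_(tau < t) \int[P]_w profit r tau w)%:E.
  rewrite /time_average EFinM -sumEFin; congr (_ * _)%E.
  apply: eq_bigr => tau _; rewrite expectation.unlock.
  by rewrite (meanE (probability_setT P))//; exact: bounded_mfun_profit.
rewrite lee_fin => total; rewrite [leRHS]mulrC ler_pdivlMr ?ltr0n//.
rewrite -(ler_pM2l V_gt0) mulrA mulrBr [V * (_ / V)]mulrC divfK ?gt_eqF//.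
by rewrite mulrC.
Qed.

End iid.

End drift.

Theorem theorem2 (R : realType) (dY : measure_display) (Y : measurableType dY)
    (smax gmax amax xmax pmax eps V : R)
    (A : R.-pker (R * Y * R)%type ~> R) (F : R -> Y -> R -> R)
    (d : measure_display) (T : measurableType d) (P : probability T R)
    (r : run Y P) :
  demand_model A F gmax amax pmax ->
  valid_run A smax gmax amax xmax pmax r ->
  Num.max amax eps <= xmax -> 0 <= eps -> 0 < V ->
  joint_pricing_allocation F xmax pmax eps V r ->
  ((forall t w, Q r t w <= Qmax V gmax amax) /\
   (0 < eps -> forall t w, fulfilled_within r (Dmax V gmax amax eps) t w)) /\
  (forall mu : probability (R * Y * R)%type R,
     iid_states mu r ->
     (exists pi, optimal_policy A mu smax gmax amax xmax pmax pi) ->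
     (eps%:E <= maxe (a_star A mu smax gmax amax xmax pmax)%:E
                     'E_P[supply r 0])%E ->
     forall t, (0 < t)%N ->
       ((phi_star A mu smax gmax amax xmax pmax
         - Bconst smax xmax amax eps / V)%:E
        <= time_average P (profit r) t)%E).
Proof.
move=> demand valid; rewrite ge_max => /andP[amax_le eps_le] eps_ge0 V_gt0 jpa.
have [[supply_bounds market_bounds] [outside_bounds _] [requests_bounds _] _]
  := valid.
have outsideE t w : outside r t w =
    if Q r t w + Z r eps t w <= V * market_price r t w then 0 else xmax.
  by have [] := jpa t w.
split; first split.
- move=> t w.
  by apply: (@Q_le _ _ _ _ _ _ r smax gmax amax xmax eps V w).
- move=> eps_gt0 t w.
  by apply: (@fulfilled_within_Dmax _ _ _ _ _ _ r smax gmax amax xmax eps V w).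
move=> mu iid opt eps_small t t_gt0.
exact: (time_average_profit_ge demand valid amax_le eps_le eps_ge0 V_gt0 jpa iid).
Qed.
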